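(* Let $G$ be a complete graph, a path, a cycle, a star, a wheel, a fan, or a complete split graph. Then the graph associahedron $\mathcal{A}(G)$ has a facet-Hamiltonian cycle.
   Context: Let $G=(V,E)$ be a connected simple graph. A tube of $G$ is a nonempty proper subset $t\subsetneq V$ such that the induced subgraph $G[t]$ is connected. Two distinct tubes $t_1,t_2$ are compatible if they are nested ($t_1\subset t_2$ or $t_2\subset t_1$) or non-adjacent ($G[t_1\cup t_2]$ is disconnected). A tubing is a set of pairwise compatible tubes. The graph associahedron $\mathcal{A}(G)$ is the (simple) polytope whose face lattice is isomorphic to the set of tubings ordered by reverse inclusion; its vertices correspond to maximal tubings, its facets to tubes (a vertex lies on the facet of tube $t$ iff $t$ belongs to the maximal tubing), and two vertices are adjacent iff the maximal tubings differ in exactly one tube. A cycle $C$ in the skeleton (vertex-edge graph) of a polytope is facet-Hamiltonian if for every facet $f$, $f\cap C$ is nonempty and connected. A star is a tree with one center adjacent to all other vertices (leaves); a fan is a path together with one extra vertex adjacent to all path vertices; a wheel is a cycle together with one extra vertex adjacent to all cycle vertices; a complete split graph consists of a clique $K$ and an independent set $I$ with every vertex of $K$ adjacent to every vertex of $I$. *)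

(* Defs.v *)
From HB Require Import structures.
From mathcomp Require Import all_boot.

Set Implicit Arguments.
Unset Strict Implicit.
Unset Printing Implicit Defensive.

(* A simple graph is a symmetric irreflexive relation [e] on a finite type. *)

Section Graphs.
Variables (T : finType) (e : rel T).
Implicit Types (A K I : {set T}) (s : seq T).

(* The subgraph induced on [A] is connected; vacuous for [A = set0]. *)
Definition connected_on A : bool :=
  [forall x in A, forall y in A,
     connect [rel u v | [&& u \in A, v \in A & e u v]] x y].

(* Edges of the path, resp. the cycle, that visits a duplicate-free [s]. *)
Definition path_edge s : rel T := fun x y =>
  (index y s == (index x s).+1) || (index x s == (index y s).+1).

Definition cycle_edge s : rel T := fun x y =>
  (next s x == y) || (next s y == x).

Definition is_path_on A : Prop := exists s,
  [/\ uniq s, s =i A & {in A &, e =2 path_edge s}].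

Definition is_cycle_on A : Prop := exists s,
  [/\ uniq s, 2 < size s, s =i A & {in A &, e =2 cycle_edge s}].

Definition acyclic : Prop := forall s, 2 < size s -> ~ ucycle e s.

Definition is_tree : Prop := connected_on setT /\ acyclic.

Definition universal (c : T) : Prop := forall x, x != c -> e c x.

Definition is_complete : Prop := forall x y, x != y -> e x y.

Definition is_path : Prop := is_path_on setT.

Definition is_cycle : Prop := is_cycle_on setT.

Definition is_star : Prop := is_tree /\ exists c, universal c.

Definition is_wheel : Prop := exists2 c, is_cycle_on [set~ c] & universal c.

Definition is_fan : Prop := exists2 c, is_path_on [set~ c] & universal c.

Definition is_complete_split : Prop := exists K I,
  [/\ K :|: I = setT, [disjoint K & I],
      {in K &, forall x y, x != y -> e x y},
      {in I &, forall x y, ~~ e x y} &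
      {in K & I, forall x y, e x y}].

End Graphs.

(* The vertices of the graph associahedron are encoded as maximal tubings and
   its facets as tubes. *)

Section GraphAssociahedron.
Variables (T : finType) (e : rel T).
Implicit Types (t : {set T}) (M : {set {set T}}).

Definition tube t : bool := [&& t != set0, t != setT & connected_on e t].

Definition compatible t1 t2 : bool :=
  [|| t1 \subset t2, t2 \subset t1 | ~~ connected_on e (t1 :|: t2)].

Definition tubing M : bool :=
  [forall t in M, tube t] &&
  [forall t1 in M, forall t2 in M, (t1 != t2) ==> compatible t1 t2].

Definition maximal_tubing M : bool := maxset tubing M.

Definition skeleton : rel {set {set T}} := fun M1 M2 =>
  [&& maximal_tubing M1, maximal_tubing M2,
      #|M1 :\: M2| == 1 & #|M2 :\: M1| == 1].

Definition facet_vertices t : {set {set {set T}}} :=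
  [set M | maximal_tubing M & t \in M].

(* An edge of a polytope lies in a face exactly when both its ends do, so the
   intersection of a facet with a cycle [C] is the subgraph of [C] induced on
   the vertices of [C] that lie on the facet. *)
Definition facet_hamiltonian (C : seq {set {set T}}) : Prop :=
  [/\ 2 < size C, ucycle skeleton C &
      forall t, tube t ->
        let fC := facet_vertices t :&: [set M in C] in
        fC != set0 /\ connected_on (cycle_edge C) fC].

End GraphAssociahedron.

(* Main.v *)
Require Import Defs.
From HB Require Import structures.
From mathcomp Require Import all_boot zify.

(* Deleting the vertices of G in the order given by a word w produces a maximal
   tubing, in which a tube t occurs exactly when all neighbours of t precede t
   in w; an adjacent transposition of w is a flip or does not change the tubing.
   It thus suffices to find a closed walk of adjacent transpositions along which
   every tube appears in exactly one cyclic run: repetitions can be cut out,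
   because any two compatible tubes are both incompatible with some third tube.

   All the closed walks below have a last part in which one letter c descends
   from the front to the back.  There the presence of each tube is monotone, so
   that only the rest of the walk, from (r, c) to (c, r), has to be understood.
   - Universal vertex u added to a graph H: run backwards through a walk for the
     complete graph on V(H) with u last, lift u to the front, then run through a
     walk for H with u first.  Complete graphs, complete split graphs, stars,
     fans and wheels are obtained by iterating this.
   - Path or cycle with consecutive vertices c, r: insertion sort from the
     reversal of (c, r) to (c, r), during which every prefix avoiding c is an
     interval of r, then a mirrored sort from (c, r) to (c, reversal of r).  The
     first half visits the tubes containing c, the second half the others. *)

Set Implicit Arguments.
Unset Strict Implicit.
Unset Printing Implicit Defensive.

(** * Runs in boolean sequences *)

(** [b] is the value read just before [s]; for [b = false] the maximal runs of [true] are
    counted. *)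
Fixpoint rises (b : bool) (s : seq bool) : nat :=
  if s is a :: s' then (~~ b && a) + rises a s' else 0.

Lemma rises_cat b s1 s2 :
  rises b (s1 ++ s2) = rises b s1 + rises (last b s1) s2.
Proof. by elim: s1 b => //= a s1 IH b; rewrite IH addnA. Qed.

Lemma rises_false s : ~~ has id s -> forall b, rises b s = 0.
Proof. by elim: s => //= -[] //= s IH Hs b; rewrite andbF IH. Qed.

Lemma rises_rev s : rises false (rev s) = rises false s.
Proof.
elim: s => // b s IH; rewrite rev_cons -cats1 rises_cat IH /= addn0.
have -> : last false (rev s) = head false s.
  by case: s {IH} => //= a s; rewrite rev_cons last_rcons.
by case: b; case: s {IH} => //= -[] s; rewrite /= ?addn0 ?add0n // addnC.
Qed.

Lemma rises_gt0 b s : ~~ (b && all id s) -> 0 < rises b (rcons s true).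
Proof.
elim: s b => [|a s IH] b /=; first by case: b.
case: a b => -[] //= H; rewrite ?add0n ?add1n //; apply: IH => //=.
Qed.

(* Cyclic runs of [true], except that an all-[true] sequence counts for [0]. *)
Definition crises s := rises (last false s) s.

Lemma crises_cat s1 s2 :
  crises (s1 ++ s2) = crises (s2 ++ s1).
Proof.
case: s1 s2 => [|a s1] [|b s2]; rewrite ?cats0 //.
by rewrite /crises !last_cat !rises_cat /= addnC.
Qed.

Lemma crises_rot k s : crises (rot k s) = crises s.
Proof. by rewrite /rot crises_cat cat_take_drop. Qed.

(** An arc that contains [false] forces a rise on the way to the [true] that ends it, so two such
    arcs would give two rises. *)
Lemma crises_arcs u v :
  crises (true :: u ++ true :: v) <= 1 -> all id u || all id v.
Proof.
rewrite /crises /= last_cat /= -cat_rcons rises_cat last_rcons => H.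
case Hu: (all id u) => //; case Hv: (all id v) => //; exfalso.
have := @rises_gt0 true u; rewrite Hu => /(_ isT).
have := @rises_gt0 true v; rewrite Hv -cats1 rises_cat => /(_ isT) /=.
move: H; lia.
Qed.

Lemma pairwise_rev (U : Type) (r : rel U) s :
  pairwise r (rev s) = pairwise (fun x y => r y x) s.
Proof. by elim: s => //= x s IH; rewrite rev_cons pairwise_rcons all_rev IH. Qed.

Section Runs.
Variable W : eqType.
Implicit Types (p q : pred W) (s : seq W).

(** Convexity: [p] holds on a block of consecutive entries, possibly empty. *)
Definition conv p s := rises false (map p s) <= 1.
Definition inc p s := pairwise (fun x y => p x ==> p y) s.
Definition dec p s := pairwise (fun x y => p y ==> p x) s.

Lemma conv_rev p s : conv p (rev s) = conv p s.
Proof. by rewrite /conv map_rev rises_rev. Qed.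

Lemma dec_rev p s : dec p (rev s) = inc p s.
Proof. exact: pairwise_rev. Qed.

Lemma inc_rev p s : inc p (rev s) = dec p s.
Proof. exact: pairwise_rev. Qed.

Lemma rises_dec p b x s :
  dec p (x :: s) -> (p x ==> b) -> rises b (map p (x :: s)) = 0.
Proof.
elim: s x b => [|y s IH] x b /=; first by case: (p x) b => -[].
case/and3P=> /andP [Hyx _] Hy Hs Hb.
rewrite -[_ + rises _ _]/(rises (p x) (map p (y :: s))) IH //=; last by rewrite Hy.
by case: (p x) b Hb => -[].
Qed.

Lemma rises_inc p b x s : inc p (x :: s) -> b ==> p x ->
  rises b (map p (x :: s)) = ~~ b && p (last x s).
Proof.
elim: s x b => [|y s IH] x b; first by rewrite /= addn0.
case/andP=> /andP [Hxy Hxs] Hs Hb; rewrite map_cons /= -[_ + rises _ _]/(rises (p x) (map p (y :: s))).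
rewrite IH //=.
have/implyP: p x -> p (last y s).
  move=> px; have := mem_last y s; rewrite inE => /orP [/eqP ->|Hl].
    exact: implyP Hxy px.
  exact: implyP (allP Hxs _ Hl) px.
by case: b Hb; case: (p x); case: (p (last y s)).
Qed.

(** [p] holds on a final segment and [q] on an initial one; their intersection is a block. *)
Lemma conv_inc_dec p q s : inc p s -> dec q s -> conv (predI p q) s.
Proof.
rewrite /conv; elim: s => //= x s IH /andP [ip ips] /andP [dq dqs].
case px: (p x); case qx: (q x); rewrite /= ?add0n ?IH //.
have -> : map (predI p q) s = map q s.
  by apply/eq_in_map => y /(allP ip); rewrite px /= => ->.
case: s ips dqs {IH dq ip} => //= y s _ H.
by have := rises_dec (b := true) H; rewrite implybT => /(_ isT) /= ->.
Qed.

Lemma eq_in_conv p q s : {in s, p =1 q} -> conv p s = conv q s.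
Proof. by move=> H; rewrite /conv (eq_in_map p q s).1. Qed.

Lemma conv_cat_none p s1 s2 :
  conv p s1 -> ~~ has p s2 -> conv p (s1 ++ s2).
Proof.
by move=> H1 H2; rewrite /conv map_cat rises_cat [X in _ + X]rises_false ?addn0 // has_map.
Qed.

Lemma conv_none_cat p s1 s2 :
  ~~ has p s1 -> conv p s2 -> conv p (s1 ++ s2).
Proof. by move=> H1 H2; rewrite -conv_rev rev_cat conv_cat_none ?conv_rev ?has_rev. Qed.

(** The repeated [x] is the entry at which two walks are joined: it carries the value of [p] across,
    and from there on [p] can only be lost. *)
Lemma conv_cat_dec p s1 x s2 :
  conv p (rcons s1 x) -> dec p (x :: s2) -> conv p (rcons s1 x ++ x :: s2).
Proof.
rewrite /conv map_cat rises_cat map_rcons last_rcons => H /rises_dec -> //.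
  by rewrite addn0.
exact: implybb.
Qed.

Lemma inc_cat_conv p s1 x s2 :
  inc p (rcons s1 x) -> conv p (x :: s2) -> conv p (rcons s1 x ++ x :: s2).
Proof.
move=> H1 H2; rewrite -conv_rev rev_cat rev_cons rev_rcons; apply: conv_cat_dec.
  by rewrite -rev_cons conv_rev.
by rewrite -rev_rcons dec_rev.
Qed.

End Runs.

(** * Connected sets of vertices *)

Section Connectivity.
Variables (T : finType) (e : rel T).
Hypothesis e_sym : symmetric e.
Implicit Types (A B X t : {set T}).

Definition restr A u v := [&& u \in A, v \in A & e u v].
Arguments restr A u v /.

Lemma restr_sym A : connect_sym (restr A).
Proof.
by apply: sym_connect_sym => x y; rewrite /restr /= e_sym andbCA.
Qed.

Lemma connected_cut A X x y : connected_on e A -> x \in A -> y \in A ->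
  x \in X -> y \notin X ->
  exists a b, [/\ a \in A, b \in A, a \in X, b \notin X & e a b].
Proof.
move=> /forall_inP /(_ x) H xA yA; have /forall_inP /(_ y yA) {H} := H xA.
case/connectP=> p; elim: p x xA => [|z p IH] x xA /=; first by move=> _ -> xX; rewrite xX.
case/andP=> /and3P [_ zA exz] pth Hy xX yX.
case zX: (z \in X); first exact: (IH z zA).
by exists x, z; rewrite zX.
Qed.

Lemma connected_from A a :
  {in A, forall z, connect (restr A) a z} -> connected_on e A.
Proof.
move=> H; apply/forall_inP => x xA; apply/forall_inP => y yA.
by apply: connect_trans (H y yA); rewrite restr_sym H.
Qed.

Lemma connect_restrS A B x y : A \subset B ->
  connect (restr A) x y -> connect (restr B) x y.
Proof.
move=> /subsetP AB; apply: connect_sub => u v /and3P [uA vA euv].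
by apply: connect1; rewrite /= !AB.
Qed.

Lemma connected_setU t1 t2 a b : connected_on e t1 -> connected_on e t2 ->
  a \in t1 -> b \in t2 -> (a == b) || e a b -> connected_on e (t1 :|: t2).
Proof.
move=> /forall_inP /(_ a) c1 /forall_inP /(_ b) c2 a1 b2 eab.
apply: (@connected_from _ a) => z; rewrite inE => /orP [z1|z2].
  apply: connect_restrS (subsetUl _ _) _; exact: (forall_inP (c1 a1)).
apply: (@connect_trans _ _ b).
  case/orP: eab => [/eqP -> //|eab].
  by apply: connect1; rewrite /= !inE a1 b2 eab orbT.
apply: connect_restrS (subsetUr _ _) _; exact: (forall_inP (c2 b2)).
Qed.

Lemma connected_set1 x : connected_on e [set x].
Proof. by apply: (@connected_from _ x) => z /set1P ->. Qed.

Definition component A x : {set T} := [set z | connect (restr A) x z].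

Lemma mem_component A x : x \in component A x.
Proof. by rewrite inE. Qed.

Lemma component_sub A x : x \in A -> component A x \subset A.
Proof.
move=> xA; apply/subsetP => z; rewrite inE => /connectP [p + ->].
by elim/last_ind: p => //= p y _; rewrite rcons_path last_rcons => /andP [_ /and3P []].
Qed.

Lemma component_closed A x a b :
  x \in A -> a \in component A x -> b \in A -> e a b -> b \in component A x.
Proof.
move=> xA aC bA eab; have /subsetP /(_ _ aC) aA := component_sub xA.
move: aC; rewrite !inE => /connect_trans; apply.
by apply: connect1; rewrite /= aA bA.
Qed.

Lemma component_connected A x : x \in A -> connected_on e (component A x).
Proof.
move=> xA; apply: (@connected_from _ x) => z; rewrite inE.
case/connectP=> p pth ->; apply/connectP; exists p => //.
elim: p x xA pth => //= y p IH x xA /andP [xy pth].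
have yA : y \in A by case/and3P: xy.
have xy' : connect (restr A) x y by apply: connect1.
(* Moving along the path does not change the component, so the whole path stays inside it. *)
have -> : component A x = component A y.
  apply/setP => w; rewrite !inE; apply/idP/idP; apply: connect_trans => //.
  by rewrite restr_sym.
rewrite IH // mem_component !inE restr_sym xy' /=.
by rewrite andbT; case/and3P: xy.
Qed.

Definition nb t x := (x \notin t) && [exists y in t, e x y].

Lemma nbP t x : reflect (x \notin t /\ exists2 y, y \in t & e x y) (nb t x).
Proof.
apply: (iffP andP) => [[xt /exists_inP H]|[xt H]]; split=> //.
exact/exists_inP.
Qed.

Lemma connected_nb A t x y : connected_on e A -> t \subset A ->
  x \in t -> y \in A -> y \notin t -> exists2 z, z \in A & nb t z.
Proof.
move=> cA /subsetP tA xt yA yt.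
case: (connected_cut cA (tA _ xt) yA xt yt) => a [b [aA bA at_ bt eab]].
by exists b => //; apply/nbP; split=> //; exists a; rewrite // e_sym.
Qed.

End Connectivity.

(** * From words to maximal tubings *)

Section Steps.
Variable T : eqType.
Implicit Types (w l r : seq T).

(** As [index] gives [size w] for an absent letter, every letter of [w] precedes all letters outside
    [w]. *)
Definition prec x y w := index x w < index y w.

(* Equal, or equal up to one adjacent transposition. *)
Fixpoint step w w' :=
  match w, w' with
  | a :: v, a' :: v' => (a == a') && step v v' ||
      match v, v' with
      | b :: r, b' :: r' => [&& a == b', b == a' & r == r']
      | _, _ => false
      end
  | _, _ => w == w'
  end.

Lemma step_refl : reflexive step.
Proof. by elim=> //= a w ->; rewrite eqxx. Qed.

Lemma step_swap l a b r : step (l ++ a :: b :: r) (l ++ b :: a :: r).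
Proof. by elim: l => [|c l IH] /=; rewrite !eqxx ?orbT ?IH. Qed.

Lemma stepP w w' : reflect
  (w = w' \/ exists l a b r, w = l ++ a :: b :: r /\ w' = l ++ b :: a :: r)
  (step w w').
Proof.
apply: (iffP idP) => [|[<-|[l [a [b [r [-> ->]]]]]]]; last 2 first.
- exact: step_refl.
- exact: step_swap.
elim: w w' => [|a w IH] [|a' w'] //=; try by move/eqP; left.
case/orP=> [/andP [/eqP <- /IH [<-|[l [b [c [r [-> ->]]]]]]]|]; first by left.
  by right; exists (a :: l), b, c, r.
case: w w' {IH} => [|b r] [|b' r'] // /and3P [/eqP <- /eqP <- /eqP <-].
by right; exists [::], a, b, r.
Qed.

Lemma step_sym : symmetric step.
Proof.
move=> w w'; apply/stepP/stepP => -[->|[l [a [b [r [-> ->]]]]]]; try by left.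
  by right; exists l, b, a, r.
by right; exists l, b, a, r.
Qed.

Lemma step_cons c w w' : step w w' -> step (c :: w) (c :: w').
Proof. by move=> /= ->; rewrite eqxx. Qed.

Lemma step_rcons c w w' : step w w' -> step (rcons w c) (rcons w' c).
Proof.
case/stepP=> [->|[l [a [b [r [-> ->]]]]]]; first exact: step_refl.
by rewrite !rcons_cat !rcons_cons step_swap.
Qed.

Lemma step_rev w w' : step w w' -> step (rev w) (rev w').
Proof.
case/stepP=> [->|[l [a [b [r [-> ->]]]]]]; first exact: step_refl.
by rewrite !rev_cat !rev_cons -!cats1 -!catA step_swap.
Qed.

Lemma step_perm w w' : step w w' -> perm_eq w w'.
Proof.
case/stepP=> [->|[l [a [b [r [-> ->]]]]]] //.
by rewrite perm_cat2l (perm_catCA [:: a] [:: b] r).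
Qed.

Lemma prec_mem x y w : prec x y w -> x \in w.
Proof. by rewrite /prec -index_mem => /leq_trans; apply; apply: index_size. Qed.

Lemma prec_total x y w : x != y -> x \in w -> prec y x w = ~~ prec x y w.
Proof.
move=> xy xw; rewrite /prec -leqNgt [RHS]leq_eqVlt; case: eqP => //= H.
have yw : y \in w by move: (xw); rewrite -!index_mem; lia.
by case/eqP: xy; rewrite -[LHS](nth_index x xw) -[RHS](nth_index x yw) H.
Qed.

Lemma prec_cons x y a w :
  prec x y (a :: w) = (a != y) && ((a == x) || prec x y w).
Proof. by rewrite /prec /=; case: (a == y); case: (a == x). Qed.

Lemma prec_cat x y w1 w2 : x \in w1 -> y \notin w1 -> prec x y (w1 ++ w2).
Proof.
move=> xw yw; rewrite /prec !index_cat xw (negbTE yw).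
by rewrite -index_mem in xw; lia.
Qed.

Lemma prec_catl x y w1 w2 : x \in w1 -> y \in w1 ->
  prec x y (w1 ++ w2) = prec x y w1.
Proof. by move=> xw yw; rewrite /prec !index_cat xw yw. Qed.

Lemma prec_rcons x y c w : x \in w -> y \in w ->
  prec x y (rcons w c) = prec x y w.
Proof. by rewrite -cats1; apply: prec_catl. Qed.

Lemma prec_rev x y w : uniq w -> x \in w -> y \in w ->
  prec x y (rev w) = prec y x w.
Proof.
elim: w => // a w IH /= /andP [aw uw]; rewrite !inE rev_cons.
case: (eqVneq x a) => [->|xa] /=; case: (eqVneq y a) => [->|ya] /=.
- by rewrite /prec !ltnn.
- move=> _ yw; rewrite prec_cons eqxx /= -cats1 /prec !index_cat !mem_rev yw (negbTE aw).
  rewrite -(mem_rev w) -index_mem in yw; lia.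
- by move=> xw _; rewrite prec_cons (eq_sym a) xa eqxx /= -cats1 prec_cat // mem_rev.
- by move=> xw yw; rewrite prec_rcons ?mem_rev // IH // prec_cons !(eq_sym a) xa (negbTE ya).
Qed.

Lemma prec_swap l a b r x y : uniq (l ++ a :: b :: r) ->
  prec x y (l ++ a :: b :: r) ->
  ~~ prec x y (l ++ b :: a :: r) -> x = a /\ y = b.
Proof.
elim: l => [|c l IH] /=.
  rewrite inE negb_or => /andP [/andP [ab ar] /andP [br ur]].
  rewrite !prec_cons.
  case: (eqVneq a x) => [<-|]; case: (eqVneq b y) => [<-|] //=;
   rewrite ?eqxx ?(negbTE ab) ?(eq_sym b) ?(negbTE ab) //=; do ?[case: eqP => //=]; try by case: prec.
case/andP=> _ /IH {}IH; rewrite !prec_cons; case: (c == y) => //=.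
by case: (c == x).
Qed.

Lemma prec_adj l a b r x : uniq (l ++ a :: b :: r) ->
  prec a x (l ++ a :: b :: r) -> prec x b (l ++ a :: b :: r) -> False.
Proof.
elim: l => [|c l IH] /=.
  rewrite inE negb_or => /andP [/andP [ab ar] /andP [br ur]].
  by rewrite !prec_cons eqxx (negbTE ab) /= eqxx /= orbF => /andP [/negbTE ->].
case/andP=> cl /IH {}IH; rewrite !prec_cons.
case: (eqVneq c x) => //= cx; case: (eqVneq c a) => [Ha|ca] /=.
  by rewrite Ha mem_cat inE eqxx orbT in cl.
by case: (c == b).
Qed.

End Steps.

(** * The tubing of a word and its maximality *)

Section Tubings.
Variables (T : finType) (e : rel T).
Hypothesis e_sym : symmetric e.
Implicit Types (A t : {set T}) (w : seq T).

(** Presence of [t] in the tubing of [w] for the subgraph induced on [A]; the inductive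
    constructions use words that list only a part of the vertices. *)
Definition pres A t w :=
  [forall x in A, forall y in t, nb e t x ==> prec x y w].

Lemma presP A t w : reflect
  (forall x y, x \in A -> nb e t x -> y \in t -> prec x y w) (pres A t w).
Proof.
apply: (iffP forall_inP) => H x.
  by move=> y xA xt yt; have /forall_inP /(_ y yt) /implyP := H x xA; apply.
by move=> xA; apply/forall_inP => y yt; apply/implyP => xt; apply: H.
Qed.

Definition tubing_of w := [set t | tube e t && pres setT t w].

Lemma incompatible_nb t1 t2 : ~~ compatible e t1 t2 -> t1 != set0 ->
  exists2 x, x \in t2 & nb e t1 x.
Proof.
rewrite /compatible !negb_or !negbK => /and3P [_ /subsetPn [y y2 y1] cU].
case/set0Pn=> x x1.
have [] := @connected_nb _ e e_sym (t1 :|: t2) t1 x y cU (subsetUl _ _) x1.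
  by rewrite inE y2 orbT.
  by [].
move=> z zU zn; exists z => //; case/nbP: (zn) => z1 _.
by move: zU; rewrite inE (negbTE z1).
Qed.

Lemma compatible_sym : symmetric (compatible e).
Proof. by move=> t1 t2; rewrite /compatible setUC orbCA. Qed.

(** Of two incompatible members each would contain a neighbour of the other, and each of these two
    vertices would have to precede the other in [w]. *)
Lemma tubing_tubing_of w : tubing e (tubing_of w).
Proof.
apply/andP; split; first by apply/forall_inP => t; rewrite inE => /andP [].
apply/forall_inP => t1; rewrite inE => /andP [/and3P [n1 _ _] /presP p1].
apply/forall_inP => t2; rewrite inE => /andP [/and3P [n2 _ _] /presP p2].
apply/implyP => _; apply/negPn/negP => inc.
have [x x2 x1] := incompatible_nb inc n1.
rewrite compatible_sym in inc; have [y y1 y2] := incompatible_nb inc n2.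
have := p1 x y (in_setT _) x1 y1; have := p2 y x (in_setT _) y2 x2.
by rewrite /prec; lia.
Qed.

Variable w : seq T.
Hypothesis w_all : forall x, x \in w.

(* If a neighbour of [t] comes after the first vertex [y0] of [t], its component
   among the vertices after [y0] is a tube of [tubing_of w] incompatible with [t]. *)
Lemma maximal_tubing_of : maximal_tubing e (tubing_of w).
Proof.
apply/maxsetP; split=> [|M /andP [/forall_inP Mt /forall_inP Mc] sM].
  exact: tubing_tubing_of.
apply/eqP; rewrite eqEsubset sM andbT; apply/subsetP => t tM.
rewrite inE (Mt _ tM) /=; apply/negPn/negP => np.
have /and3P [/set0Pn [y1 y1t] _ ct] := Mt _ tM.
have [y0 y0t y0min] := @arg_minnP _ y1 (mem t) (index^~ w) y1t.
have [x [xt x0]] : exists x, nb e t x /\ prec y0 x w.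
  case/forallPn: np => x; rewrite negb_imply => /andP [_ /forallPn [y]].
  rewrite !negb_imply => /and3P [yt xt nxy]; exists x; split=> //.
  case/nbP: (xt) => xt' _; have xy : x != y by apply: contraNneq xt' => ->.
  by move: nxy; rewrite -prec_total // /prec; apply: leq_trans; apply: y0min.
set B := [set z | prec y0 z w]; have xB : x \in B by rewrite inE.
have y0B : y0 \notin component e B x.
  by apply/negP => /(subsetP (component_sub e xB)); rewrite inE /prec ltnn.
have sT : component e B x \in tubing_of w.
  rewrite inE; apply/andP; split.
    apply/and3P; split.
    - by apply/set0Pn; exists x; apply: mem_component.
    - by apply: contraNneq y0B => ->; rewrite inE.
    - exact: component_connected.
  apply/presP => a b _ /nbP [aC [c cC eac]] bC.
  have : a \notin B.
    by apply: contra aC => aB; apply: (component_closed xB cC aB); rewrite e_sym.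
  move/(subsetP (component_sub e xB)): bC; rewrite !inE -leqNgt => yb ay; apply: leq_ltn_trans ay yb.
case/nbP: xt => xt [z zt exz].
have nst : component e B x != t by apply: contraNneq y0B => ->.
have /forall_inP /(_ _ tM) := Mc _ (subsetP sM _ sT).
rewrite nst /= /compatible; apply/negP; rewrite !negb_or negbK; apply/and3P; split.
- by apply/subsetPn; exists x; rewrite // mem_component.
- by apply/subsetPn; exists y0.
- by apply: (connected_setU e_sym _ ct (mem_component e B x) zt); rewrite ?exz ?orbT // component_connected.
Qed.

End Tubings.

(** * Adjacent transpositions as flips *)

Section Flip.
Variables (T : finType) (e : rel T).
Hypothesis e_sym : symmetric e.
Implicit Types (t : {set T}) (w : seq T).

(* A tube lost by swapping [a] and [b] contains [b] and has [a] as a neighbour,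
   and two such tubes can only be nested if they are equal. *)
Lemma card_tubing_swap l a b r : uniq (l ++ a :: b :: r) ->
  #|tubing_of e (l ++ a :: b :: r) :\: tubing_of e (l ++ b :: a :: r)| <= 1.
Proof.
set w := l ++ _; set w' := l ++ _ => uw.
have key t : t \in tubing_of e w :\: tubing_of e w' -> nb e t a /\ b \in t.
  rewrite !inE; case/andP; case: (tube e t) => //= np /presP pw.
  case/forallPn: np => x; rewrite negb_imply => /andP [_ /forallPn [y]].
  rewrite !negb_imply => /and3P [yt xt nxy].
  by have [<- <-] := prec_swap uw (pw x y (in_setT x) xt yt) nxy.
apply/card_le1_eqP => t1 t2 D1 D2.
have [a1 b1] := key _ D1; have [a2 b2] := key _ D2.
have {D1} := D1; have {D2} := D2; rewrite !inE.
case/and3P=> _ tb2 /presP p2 /and3P [_ tb1 /presP p1].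
case/and3P: (tb1) => n1 _ c1; case/and3P: (tb2) => n2 _ c2.
have sub s1 s2 : nb e s1 a -> nb e s2 a -> b \in s1 -> b \in s2 -> 
    (forall x y, x \in setT -> nb e s1 x -> y \in s1 -> prec x y w) ->
    (forall x y, x \in setT -> nb e s2 x -> y \in s2 -> prec x y w) ->
    connected_on e s2 -> connected_on e s1 -> s2 \subset s1.
  move=> as1 as2 bs1 bs2 ps1 ps2 cs2 cs1; apply/subsetP => y ys2.
  apply/negPn/negP => ys1.
  have cU := connected_setU e_sym cs1 cs2 bs1 bs2 (introT orP (or_introl (eqxx b))).
  have [] := @connected_nb _ e e_sym _ s1 b y cU (subsetUl _ _) bs1 _ ys1.
    by rewrite inE ys2 orbT.
  move=> z zU zn; have zs2 : z \in s2 by case/nbP: zn zU => /negbTE; rewrite inE => ->.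
  (* [a] is a neighbour of [s2], which contains [z], and [z] is a neighbour of [s1], which contains
     [b]; so [z] would lie strictly between the adjacent letters [a] and [b]. *)
  by apply: (@prec_adj _ l a b r z) => //; [apply: ps2|apply: ps1].
by apply/eqP; rewrite eqEsubset !sub.
Qed.

(** Two distinct maximal tubings each have a tube that the other lacks, and [card_tubing_swap],
    applied in both directions, allows no second one. *)
Lemma step_tubing w w' : uniq w -> (forall x, x \in w) -> step w w' ->
  (tubing_of e w == tubing_of e w') || skeleton e (tubing_of e w) (tubing_of e w').
Proof.
move=> uw aw st; have uw' : uniq w' by rewrite -(perm_uniq (step_perm st)).
have aw' x : x \in w' by rewrite -(perm_mem (step_perm st)).
have mw := maximal_tubing_of e_sym aw; have mw' := maximal_tubing_of e_sym aw'.
case: eqVneq => //= nww; rewrite /skeleton mw mw' /=.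
have D1 : tubing_of e w :\: tubing_of e w' != set0.
  rewrite setD_eq0; apply: contra nww => sub; rewrite eq_sym; apply/eqP.
  by case/maxsetP: mw => _; apply=> //; case/maxsetP: mw'.
have D2 : tubing_of e w' :\: tubing_of e w != set0.
  rewrite setD_eq0; apply: contra nww => sub; apply/eqP.
  by case/maxsetP: mw' => _; apply=> //; case/maxsetP: mw.
rewrite -!card_gt0 in D1 D2.
case/stepP: st => [E|[l [a [b [r [E E']]]]]]; first by rewrite E eqxx in nww.
have := @card_tubing_swap l a b r; have := @card_tubing_swap l b a r.
by rewrite -E -E' uw uw' => /(_ isT) H1 /(_ isT) H2; rewrite !eqn_leq D1 D2 H1 H2.
Qed.

End Flip.

(** * From closed walks to facet-Hamiltonian cycles *)

Section Closing.
Variables (T : finType) (e : rel T).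
Hypotheses (e_sym : symmetric e) (e_conn : connected_on e [set: T]).
Implicit Types (t r : {set T}) (M : {set {set T}}) (C : seq {set {set T}}).

Lemma incompatibleI r t : connected_on e r -> connected_on e t ->
  ~~ (r \subset t) -> ~~ (t \subset r) ->
  (exists a b, [/\ a \in r, b \in t & e a b]) -> ~~ compatible e r t.
Proof.
move=> cr ct rt tr [a [b [ar bt eab]]].
by rewrite /compatible !negb_or rt tr negbK (connected_setU e_sym cr ct ar bt) // eab orbT.
Qed.

(** Pick [a] in [t1] and [x] outside [t2]. The component [r] of [x] after deletion of [a] is
    adjacent to [a], so it is incompatible with every tube that contains [a] but not [x]. *)
Lemma nested_incompatible t1 t2 : tube e t1 -> tube e t2 -> t1 \subset t2 ->
  exists r, [/\ tube e r, ~~ compatible e r t1 & ~~ compatible e r t2].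
Proof.
case/and3P=> /set0Pn [a a1] _ c1 /and3P [_ n2 c2] /subsetP s12.
have {n2} [x x2] : exists x, x \notin t2.
  by apply/existsP; rewrite -negb_forall; apply: contra n2 => /forallP H; apply/eqP/setP => x; rewrite H inE.
have xa : x \in [set~ a] by rewrite !inE; apply: contraNneq x2 => ->; apply: s12.
set r := component e [set~ a] x.
have ar : a \notin r.
  by apply/negP => /(subsetP (component_sub e xa)); rewrite !inE eqxx.
have cr : connected_on e r by apply: component_connected.
have xr : x \in r by apply: mem_component.
have [z zr eza] : exists2 z, z \in r & e z a.
  have [b [d [_ _ br dr ebd]]] := connected_cut e_conn (in_setT x) (in_setT a) xr ar.
  suff <- : d = a by exists b.
  apply/eqP/negPn/negP => da; case/negP: dr.
  by apply: component_closed ebd => //; rewrite !inE.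
have inc t : connected_on e t -> a \in t -> x \notin t -> ~~ compatible e r t.
  move=> ct at_ xt; apply: incompatibleI => //; last by exists z, a.
    by apply/subsetPn; exists x.
  by apply/subsetPn; exists a.
exists r; split.
- apply/and3P; split=> //; first by apply/set0Pn; exists x.
  by apply: contraNneq ar => ->; rewrite inE.
- by apply: inc => //; apply: contra x2; apply: s12.
- by apply: inc => //; apply: s12.
Qed.

(* A component of the complement of [t1 :|: t2] that touches both. *)
Lemma separated_incompatible t1 t2 : tube e t1 -> tube e t2 ->
  ~~ connected_on e (t1 :|: t2) ->
  exists r, [/\ tube e r, ~~ compatible e r t1 & ~~ compatible e r t2].
Proof.
case/and3P=> /set0Pn [a a1] _ c1 /and3P [/set0Pn [b b2] _ c2] nU.
have sep x y : x \in t1 -> y \in t2 -> (x == y) || e x y -> False.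
  by move=> x1 y2 xy; case/negP: nU; apply: connected_setU xy.
set A := ~: (t1 :|: t2).
(* [X] is [t1] with all components of [A] that touch it. An edge leaving [X] can only run from such
   a component to [t2]. *)
pose X := t1 :|: [set z | [exists n in A, nb e t1 n && (z \in component e A n)]].
have bX : b \notin X.
  rewrite !inE negb_or; apply/andP; split.
    by apply/negP => b1; apply: (sep b b) => //; rewrite eqxx.
  apply/negP => /exists_inP [n nA /andP [_]].
  by move/(subsetP (component_sub e nA)); rewrite !inE b2 orbT.
have aX : a \in X by rewrite inE a1.
have [z [y [_ _ zX yX ezy]]] := connected_cut e_conn (in_setT a) (in_setT b) aX bX.
move: yX; rewrite inE negb_or => /andP [y1 yX].
have [zn y2 {zX}] : (exists2 n, n \in A & nb e t1 n && (z \in component e A n)) /\ y \in t2.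
  move: zX; rewrite !inE => /orP [z1|/exists_inP zn].
    have y2 : y \notin t2 by apply/negP => y2; apply: (sep z y) => //; rewrite ezy orbT.
    case/negP: yX; rewrite inE; apply/exists_inP; exists y; first by rewrite !inE negb_or y1.
    rewrite mem_component andbT; apply/nbP; split=> //; exists z => //; by rewrite e_sym.
  split=> //; apply/negPn/negP => y2; case: zn => n nA /andP [n1 zn].
  case/negP: yX; rewrite inE; apply/exists_inP; exists n => //; rewrite n1 /=.
  by apply: component_closed zn _ ezy => //; rewrite !inE negb_or y1.
case: zn => n nA /andP [/nbP [n1 [m m1 enm]] zn].
have cr := component_connected e_sym nA.
have rA := component_sub e nA.
set r := component e A n in zn cr rA *.
have nr : n \in r by apply: mem_component.
exists r; split.
- apply/and3P; split=> //; first by apply/set0Pn; exists n.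
  by apply/eqP => rT; have := subsetP rA a; rewrite rT !inE a1 => /(_ isT).
- apply: incompatibleI => //; last by exists n, m.
    by apply/subsetPn; exists n.
  by apply/subsetPn; exists a => //; apply/negP => /(subsetP rA); rewrite !inE a1.
- apply: incompatibleI => //; last by exists z, y.
    apply/subsetPn; exists n => //.
    by move: nA; rewrite !inE negb_or => /andP [].
  by apply/subsetPn; exists b => //; apply/negP => /(subsetP rA); rewrite !inE b2 orbT.
Qed.

Lemma common_incompatible t1 t2 : tube e t1 -> tube e t2 ->
  (t1 != t2) ==> compatible e t1 t2 ->
  exists r, [/\ tube e r, ~~ compatible e r t1 & ~~ compatible e r t2].
Proof.
move=> tb1 tb2; case: eqVneq => [<- _|_ /or3P []].
- exact: nested_incompatible.
- exact: nested_incompatible.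
- by move=> /(nested_incompatible tb2 tb1) [r [? ? ?]]; exists r.
- exact: separated_incompatible.
Qed.

(** Members of one tubing are compatible, so some tube [r] is incompatible with both and shares a
    tubing with neither. *)
Lemma no_common_incompatible M t1 t2 :
  maximal_tubing e M -> t1 \in M -> t2 \in M ->
  (forall r, tube e r -> exists2 M', maximal_tubing e M' & 
     r \in M' /\ (t1 \in M' \/ t2 \in M')) -> False.
Proof.
move=> /maxsetp /andP [/forall_inP Mt /forall_inP Mc] m1 m2 H.
have [|r [tr r1 r2]] := common_incompatible (Mt _ m1) (Mt _ m2).
  exact: (forall_inP (Mc _ m1)).
have [M' /maxsetp /andP [_ /forall_inP Mc'] [rM' tM']] := H r tr.
have comp t : t \in M' -> compatible e r t.
  move=> tM; have /forall_inP /(_ t tM) := Mc' _ rM'; case: eqVneq => //= -> _.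
  by rewrite /compatible subxx.
by case: tM' => /comp; apply/negP.
Qed.

Definition flip_or_eq : rel {set {set T}} := fun M M' => (M == M') || skeleton e M M'.

(** A facet-Hamiltonian closed walk in which stalls and repeated vertices are still allowed. A tube
    present throughout has [crises] equal to 0, hence the inequality. *)
Definition once C := [/\ all (maximal_tubing e) C, cycle flip_or_eq C &
  forall t, tube e t -> has (fun M => t \in M) C /\
    crises [seq t \in M | M : {set {set T}} <- C] <= 1].

Lemma once_catC C1 C2 : once (C1 ++ C2) -> once (C2 ++ C1).
Proof.
case=> mC cC tC; split.
- by move: mC; rewrite !all_cat andbC.
- by rewrite -(rot_size_cat C1) rot_cycle.
- by move=> t /tC; rewrite !has_cat orbC !map_cat crises_cat.
Qed.

Lemma once_drop M C : once [:: M, M & C] -> once (M :: C).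
Proof.
case=> /= /and3P [mM _ mC] /andP [_ cC] tC; split=> //=; first by rewrite mM.
by move=> t /tC [] /=; rewrite orbA orbb /crises /= andNb.
Qed.

(* If each of the two arcs from [M] to [M] missed a tube of [M], a tube that is
   incompatible with both could occur on neither arc. *)
Lemma once_repeat M C1 C2 : once (M :: C1 ++ M :: C2) ->
  all (pred1 M) C1 \/ all (pred1 M) C2.
Proof.
case=> mC _ tC; have mM : maximal_tubing e M by case/andP: mC.
have mall := allP mC; have {}mC M' : M' \in C1 ++ C2 -> maximal_tubing e M'.
  move: mC; rewrite /= all_cat /= => /and4P [_ m1 _ m2].
  by rewrite mem_cat => /orP []; apply/allP.
have arcs t : t \in M -> all (fun M' => t \in M') C1 || all (fun M' => t \in M') C2.
  move=> tM; have tt : tube e t.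
    by case/andP: (maxsetp mM) => /forall_inP /(_ _ tM).
  have [_] := tC _ tt; rewrite /= map_cat /= tM => /crises_arcs.
  by rewrite !all_map.
have full D : {subset D <= C1 ++ C2} -> ~~ all (pred1 M) D ->
    exists2 t, t \in M & ~~ all (fun M' : {set {set T}} => t \in M') D.
  move=> sD /allPn [M' M'D nM]; have [t tM tM'] : exists2 t, t \in M & t \notin M'.
    apply/subsetPn; apply: contra nM => sMM'; apply/eqP.
    by case/maxsetP: mM => _; apply=> //; apply: maxsetp; apply/mC/sD.
  by exists t => //; apply/allPn; exists M'.
case n1: (all (pred1 M) C1); first by left.
case n2: (all (pred1 M) C2); first by right.
have [|t1 t1M nt1] := full C1 _ (negbT n1); first by move=> x; rewrite mem_cat => ->.
have [|t2 t2M nt2] := full C2 _ (negbT n2); first by move=> x; rewrite mem_cat orbC => ->.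
have a1 : all (fun M' => t1 \in M') C2 by have := arcs _ t1M; rewrite (negbTE nt1).
have a2 : all (fun M' => t2 \in M') C1.
  by have := arcs _ t2M; rewrite (negbTE nt2) orbF.
exfalso; apply: (no_common_incompatible mM t1M t2M) => r tr.
have [/hasP [M' M'C rM'] _] := tC _ tr; exists M'; first exact: mall.
split=> //; move: M'C; rewrite inE mem_cat inE => /or4P [/eqP ->|M1|/eqP ->|M2]; try by left.
  by right; apply: (allP a2).
by left; apply: (allP a1).
Qed.

(** If a tubing [M] repeats, [once_repeat] makes one of the two arcs between its occurrences
    constant. After a rotation two copies of [M] stand side by side at the front; one is deleted,
    and induction on the length applies. *)
Lemma once_uniq C : once C -> exists2 C', once C' & uniq C'.
Proof.
have [n] := ubnP (size C); elim: n C => // n IH C; rewrite ltnS => sC oC.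
case uC: (uniq C); first by exists C.
suff [M [C' [oC' sC']]] : exists M C', once [:: M, M & C'] /\ (size C').+2 = size C.
  by apply: (IH (M :: C')); [rewrite /= sC' | apply: once_drop].
have [C1 [M [C2 [C3 E]]]] : exists C1 M C2 C3, C = C1 ++ M :: C2 ++ M :: C3.
  elim: C {IH sC oC} uC => //= M C IH.
  case MC: (M \in C) => /=.
    by move=> _; case/splitPr: MC => C2 C3; exists [::], M, C2, C3.
  by case/IH=> C1 [M' [C2 [C3 ->]]]; exists (M :: C1), M', C2, C3.
have {}oC : once (M :: C2 ++ M :: (C3 ++ C1)).
  by move: oC; rewrite E => /once_catC; rewrite /= -catA.
have hd D D' : once (M :: D ++ M :: D') -> all (pred1 M) D ->
    exists C', once [:: M, M & C'] /\ size C' = size D + size D'.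
  case: D => [|M' D] oD; first by exists D'.
  case/andP=> /eqP EM _; rewrite EM in oD; exists (D ++ M :: D'); split=> //.
  by rewrite /= size_cat /= addnS.
have [a|a] := once_repeat oC.
  have [C' [oC' sC']] := hd _ _ oC a; exists M, C'; split=> //.
  by rewrite E sC' !size_cat /= size_cat /=; lia.
have [|C' [oC' sC']] := hd (C3 ++ C1) C2 _ a.
  by move/(@once_catC (M :: C2)): oC.
exists M, C'; split=> //.
by rewrite E sC' !size_cat /= size_cat /=; lia.
Qed.

Hypotheses (T_gt2 : 2 < #|T|).

Lemma tube_set1 x : tube e [set x].
Proof.
apply/and3P; split; last exact: connected_set1.
  by apply/set0Pn; exists x; apply: set11.
by apply: contraTneq T_gt2 => E; rewrite -cardsT -E cards1.
Qed.

(** Otherwise at most two tubings [M] and [M'] contain all tubes. There are at least [#|T| > 2]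
    tubes, the singletons, and each tubing has at most one tube of its own, so the two share a tube;
    that tube would be compatible with all others. *)
Lemma once_size C : once C -> 2 < size C.
Proof.
case=> mC cC tC; rewrite ltnNge; apply/negP => sC.
have [x _] : exists x : T, true by case/card_gt0P: (leq_trans (isT : 0 < 3) T_gt2) => x _; exists x.
have [M [M' [mM CM sM]]] : exists M M', [/\ maximal_tubing e M,
    {subset C <= [:: M; M']} & #|M' :\: M| <= 1 /\ #|M :\: M'| <= 1].
  case: C sC mC cC {tC} (tC _ (tube_set1 x)) => [|M [|M' []]] //= _.
  - by move=> _ _ [].
  - move=> /andP [mM _] _ _; exists M, M; rewrite setDv cards0; split=> //.
    by move=> N; rewrite !inE => ->.
  - move=> /and3P [mM _ _] /and3P [H _ _] _; exists M, M'; split=> //.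
    case/orP: H => [/eqP <-|/and4P [_ _ /eqP -> /eqP ->]] //.
    by rewrite setDv cards0.
have tU t : tube e t -> t \in M :|: M'.
  case/tC=> /hasP [N /CM]; rewrite !inE.
  by case/orP=> /eqP -> ->; rewrite ?orbT.
have : 0 < #|M :&: M'|.
  have : #|T| <= #|M :|: M'|.
    rewrite -(card_imset predT (@set1_inj T)); apply: subset_leq_card.
    by apply/subsetP => _ /imsetP [y _ ->]; apply/tU/tube_set1.
  have := cardsID M' M; have := cardsID M M'; have := cardsUI M M'.
  rewrite (setIC M' M); case: sM; move: T_gt2; lia.
case/card_gt0P=> t /setIP [tM tM'].
apply: (no_common_incompatible mM tM tM) => r tr.
have [/hasP [N NC rN] _] := tC _ tr; exists N; first exact: (allP mC).
split=> //; left; move: (CM _ NC); rewrite !inE => /orP [] /eqP -> //.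
Qed.

Lemma next_neq C M : uniq C -> 1 < size C -> M \in C -> next C M != M.
Proof.
move=> uC sC MC; case: (rot_to MC) => i C' E; rewrite -(next_rot i uC) E.
have := sC; rewrite -(size_rot i) E; have := uC; rewrite -(rot_uniq i) E.
case: C' {E} => //= N C'; rewrite inE negb_or eqxx eq_sym.
by case/andP=> /andP [].
Qed.

Lemma connect_arc C (F : {set {set {set T}}}) i N1 U N2 V : uniq C ->
  rot i C = N1 :: U ++ N2 :: V -> {subset N1 :: rcons U N2 <= F} ->
  connect (restr (cycle_edge C) F) N1 N2.
Proof.
move=> uC E sF; have := cycle_next uC; rewrite -(rot_cycle i) E /=.
rewrite rcons_cat cat_path /= => /and3P [pU pN _].
apply/connectP; exists (rcons U N2); last by rewrite last_rcons.
have {pU pN} : path (frel (next C)) N1 (rcons U N2) by rewrite rcons_path pU.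
elim: (rcons U N2) N1 sF {E} => //= N D IH N1 sF /andP [eN pD].
rewrite /restr /cycle_edge eN !sF ?inE ?eqxx ?orbT //=; apply: IH => // x xD.
by apply: sF; rewrite inE xD orbT.
Qed.

Lemma facet_hamiltonian_once C : once C -> exists C, facet_hamiltonian e C.
Proof.
case/once_uniq=> {}C oC uC; have sC := once_size oC; case: (oC) => mC cC tC.
exists C; split=> //.
  apply/andP; split=> //; apply: cycle_from_next => // M MC.
  have := next_cycle cC MC; rewrite /flip_or_eq eq_sym.
  by rewrite (negbTE (next_neq uC (ltnW sC) MC)).
move=> t tt fC; have [/hasP [M MC tM] tC1] := tC _ tt.
have fCE N : (N \in fC) = (N \in C) && (t \in N).
  rewrite !inE andbC; case NC: (N \in C) => //=.
  by rewrite (allP mC).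
split; first by apply/set0Pn; exists M; rewrite fCE MC.
have ce_sym : symmetric (cycle_edge C) by move=> x y; rewrite /cycle_edge orbC.
apply: (@connected_from _ _ ce_sym fC M) => N.
case: (eqVneq M N) => [<- //|MN]; rewrite fCE => /andP [NC tN].
case: (rot_to MC) => i C' E; have NC' : N \in C'.
  by move: NC; rewrite -(mem_rot i) E inE eq_sym (negbTE MN).
case/splitPr: NC' E => U V E.
have mE x : (x \in C) = (x \in M :: U ++ N :: V) by rewrite -E mem_rot.
move: tC1; rewrite -(crises_rot i) -map_rot E /= map_cat /= tM tN.
(* One of the two arcs between [M] and [N] lies entirely on the facet. For the second arc the cycle
   is rotated once more, so as to start at [N]. *)
move=> /crises_arcs; rewrite !all_map => /orP [/allP|/allP] tU.
  apply: (connect_arc uC E) => x; rewrite fCE mE !(inE, mem_cat, mem_rcons).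
  case/or3P=> [/eqP ->|/eqP ->|xU]; rewrite ?eqxx ?orbT ?tM ?tN ?xU ?orbT //; exact: tU.
rewrite restr_sym //.
have E' : rot (size (M :: U)) (rot i C) = N :: V ++ M :: U.
  by rewrite E -cat_cons rot_size_cat.
have uC' : uniq (rot i C) by rewrite rot_uniq.
have := @connect_arc _ fC _ _ _ _ _ uC' E'.
have -> : connect (restr (cycle_edge (rot i C)) fC) N M = connect (restr (cycle_edge C) fC) N M.
  by apply: eq_connect => x y; rewrite /restr /cycle_edge !next_rot.
apply=> x; rewrite fCE mE !(inE, mem_cat, mem_rcons).
case/or3P=> [/eqP ->|/eqP ->|xU]; rewrite ?eqxx ?orbT ?tM ?tN ?xU ?orbT //; exact: tU.
Qed.

End Closing.

(** * Walks of words *)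

Section Walks.
Variable T : eqType.
Implicit Types (w l r : seq T) (s : seq (seq T)).

Definition walk s a b :=
  exists2 s', s = a :: s' & path (@step T) a s' && (last a s' == b).

Lemma walk1 a : walk [:: a] a a.
Proof. by exists [::]; rewrite //= eqxx. Qed.

(** The word [b] at the joint is kept twice, which reflexivity of [step] permits. *)
Lemma walk_cat s1 s2 a b c : walk s1 a b -> walk s2 b c -> walk (s1 ++ s2) a c.
Proof.
case=> s1' -> /andP [p1 /eqP l1] [s2' -> /andP [p2 l2]].
exists (s1' ++ b :: s2') => //.
by rewrite cat_path last_cat p1 /= l1 step_refl p2.
Qed.

Lemma walk_rcons s a b c : walk s a b -> step b c -> walk (rcons s c) a c.
Proof.
case=> s' -> /andP [p1 /eqP l1] st; exists (rcons s' c) => //.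
by rewrite rcons_path last_rcons p1 l1 st eqxx.
Qed.

Lemma walk_map f s a b : {homo f : x y / step x y} ->
  walk s a b -> walk (map f s) (f a) (f b).
Proof.
move=> hf [s' -> /andP [p /eqP <-]]; exists (map f s') => //.
by rewrite last_map eqxx andbT; apply: homo_path hf p.
Qed.

Lemma walk_rev s a b : walk s a b -> walk (rev s) b a.
Proof.
case=> s' -> {s}; elim: s' a => [|c s IH] a /=; first by move/eqP <-; apply: walk1.
case/andP=> /andP [ac p] l; rewrite rev_cons; apply: walk_rcons (IH c _) _; first by rewrite p.
by rewrite step_sym.
Qed.

Lemma walk_perm s a b w : walk s a b -> w \in s -> perm_eq a w.
Proof.
case=> s' -> /andP [p _]; rewrite inE => /orP [/eqP -> //|].
elim: s' a p => //= c s' IH a /andP [/step_perm ac p].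
rewrite inE => /orP [/eqP -> //|/(IH _ p)]; exact: perm_trans.
Qed.

Lemma walk_first s a b : walk s a b -> a \in s.
Proof. by case=> s' -> _; rewrite mem_head. Qed.

Lemma walk_last s a b : walk s a b -> b \in s.
Proof. by case=> s' -> /andP [_ /eqP <-]; rewrite mem_last. Qed.

Lemma walk_conv_dec p s1 s2 a b c : walk s1 a b -> walk s2 b c ->
  conv p s1 -> dec p s2 -> conv p (s1 ++ s2).
Proof.
case=> s1' -> /andP [_ /eqP <-] [s2' -> _]; rewrite lastI => c1 d2.
exact: conv_cat_dec.
Qed.

Lemma walk_inc_conv p s1 s2 a b c : walk s1 a b -> walk s2 b c ->
  inc p s1 -> conv p s2 -> conv p (s1 ++ s2).
Proof.
case=> s1' -> /andP [_ /eqP <-] [s2' -> _]; rewrite lastI => c1 d2.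
exact: inc_cat_conv.
Qed.

Fixpoint bubble c l :=
  if l is a :: l' then rcons (map (cons a) (bubble c l')) (c :: l) else [:: [:: c]].

Lemma bubble_walk c l : walk (bubble c l) (rcons l c) (c :: l).
Proof.
elim: l => [|a l IH] /=; first exact: walk1.
apply: walk_rcons (walk_map _ IH) _; first by move=> ? ?; apply: step_cons.
exact: (step_swap [::]).
Qed.

Lemma bubble_prec c l x y w : w \in bubble c l -> x != c -> y != c ->
  prec x y w = prec x y l.
Proof.
elim: l w => [|a l IH] w /=.
  rewrite inE => /eqP -> xc yc.
  by rewrite /prec /= !(eq_sym c) (negbTE xc) (negbTE yc).
rewrite mem_rcons inE => /orP [/eqP ->|/mapP [w' w'b ->]] xc yc.
  by rewrite prec_cons !(eq_sym c) (negbTE xc) yc.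
by rewrite !prec_cons IH.
Qed.

(** Only comparisons with [c] change, and [c] comes to precede more and more letters. *)
Lemma bubble_inc c l x y : y != c -> inc (prec x y) (bubble c l).
Proof.
move=> yc; elim: l => //= a l IH.
rewrite /inc pairwise_rcons all_map pairwise_map; apply/andP; split.
  apply/allP => w wb /=; rewrite [prec _ _ (c :: _)]prec_cons (eq_sym c y) yc /=.
  case: (eqVneq c x) => [|cx] /=; first by rewrite implybT.
  by rewrite !prec_cons (bubble_prec wb) ?implybb // eq_sym.
apply: sub_pairwise IH => w w' /=; rewrite !prec_cons.
by case: (a == y) => //=; case: (a == x).
Qed.

Lemma bubble_dec c l x y : x != c -> dec (prec x y) (bubble c l).
Proof.
move=> xc; elim: l => //= a l IH.
rewrite /dec pairwise_rcons all_map pairwise_map; apply/andP; split.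
  apply/allP => w wb /=; rewrite [prec _ _ (c :: _)]prec_cons (eq_sym c x) (negbTE xc).
  case: (eqVneq c y) => //= cy.
  by rewrite !prec_cons (bubble_prec wb) ?implybb // eq_sym.
apply: sub_pairwise IH => w w' /=; rewrite !prec_cons.
by case: (a == y) => //=; case: (a == x).
Qed.

End Walks.

Lemma incP (W : eqType) (p : pred W) x0 s :
  reflect (forall i j, i < j -> j < size s -> p (nth x0 s i) -> p (nth x0 s j))
          (inc p s).
Proof.
apply: (iffP (pairwiseP x0)) => H i j.
  move=> ij js; apply/implyP; apply: H => //.
  exact: ltn_trans js.
by move=> _ js ij; apply/implyP; apply: H.
Qed.

Lemma conv_true (W : eqType) (p : pred W) (s : seq W) : {in s, forall w, p w} -> conv p s.
Proof.
move=> H; rewrite /conv (eq_in_map p predT s).1 //.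
have r0 (s' : seq W) : rises true (map predT s') = 0 by elim: s'.
by case: s {H} => //= x s; rewrite r0.
Qed.

(** * Strips and the cone construction *)

Section Strips.
Variables (T : finType).
Implicit Types (e : rel T) (A t : {set T}) (w l : seq T) (s : seq (seq T)).

Lemma pres_inc e A t s :
  (forall x y, x \in A -> nb e t x -> y \in t -> inc (prec x y) s) ->
  inc (pres e A t) s.
Proof.
move=> H; apply/(incP _ [::]) => i j ij js /presP p; apply/presP => x y xA xt yt.
by apply: (incP _ _ _ (H x y xA xt yt) i j) => //; apply: p.
Qed.

Lemma pres_dec e A t s :
  (forall x y, x \in A -> nb e t x -> y \in t -> dec (prec x y) s) ->
  dec (pres e A t) s.
Proof.
move=> H; rewrite -inc_rev; apply: pres_inc => x y xA xt yt.
by rewrite inc_rev; apply: H.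
Qed.

(** Outside [t], the letter [c] can only be a neighbour required to come early, so moving it forward
    never hurts. *)
Lemma bubble_pres_inc e A t c l : c \notin t -> inc (pres e A t) (bubble c l).
Proof.
move=> ct; apply: pres_inc => x y _ _ yt; apply: bubble_inc.
by apply: contraNneq ct => <-.
Qed.

(** Inside [t], the letter [c] is only required to come late. *)
Lemma bubble_pres_dec e A t c l : c \in t -> dec (pres e A t) (bubble c l).
Proof.
move=> ct; apply: pres_dec => x y _ /nbP [xt _] _; apply: bubble_dec.
by apply: contraNneq xt => ->.
Qed.

(* [a] and [b] will be [rcons l c] and [c :: l]: moving [c] back from the front of
   [b] to the end of [a] closes the walk without creating new runs. *)
Definition strip e A a b := exists2 s, walk s a b &
  forall t, t != set0 -> t \subset A -> connected_on e t ->
    conv (pres e A t) s /\ has (pres e A t) s.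

Lemma pres_top e A w : pres e A A w.
Proof. by apply/presP => x y xA /nbP []; rewrite xA. Qed.

(** Since [t] contains [u], every vertex outside [t] is a neighbour of [t], as in a complete graph;
    comparisons with [u] itself hold because [u] is last. *)
Lemma pres_rcons e A t u w : u \notin A -> w =i A ->
  {in A, forall x, e u x} -> symmetric e -> u \in t -> t \subset u |: A ->
  pres e (u |: A) t (rcons w u) = pres (fun x y => x != y) A (t :\ u) w.
Proof.
move=> uA wA eu e_sym ut tA; apply/presP/presP => H x y.
  move=> xA /nbP [xt _]; rewrite in_setD1 => /andP [yu yt].
  have yA : y \in A by move/(subsetP tA): yt; rewrite inE in_set1 (negbTE yu).
  have xu : x != u by apply: contraNneq uA => <-.
  rewrite -(@prec_rcons _ x y u) ?wA //; apply: H => //; first by rewrite inE xA orbT.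
  by apply/nbP; split; [move: xt; rewrite in_setD1 xu | exists u; rewrite // e_sym eu].
move=> xA' /nbP [xt _] yt; have xu : x != u by apply: contraNneq xt => ->.
have xA : x \in A by move: xA'; rewrite !inE (negbTE xu).
case: (eqVneq y u) => [->|yu]; first by rewrite -cats1 prec_cat ?wA.
have yA : y \in A by move/(subsetP tA): yt; rewrite inE in_set1 (negbTE yu).
rewrite prec_rcons ?wA //; apply: H => //; last by rewrite in_setD1 yu.
apply/nbP; rewrite in_setD1 (negbTE xt) andbF; split=> //.
by exists y; [rewrite in_setD1 yu | apply: contraNneq xt => ->].
Qed.

Lemma pres_cons e A t u w : u \notin A -> t \subset A ->
  pres e (u |: A) t (u :: w) = pres e A t w.
Proof.
move=> uA tA; apply/presP/presP => H x y.
  move=> xA xt yt; have := H x y; rewrite prec_cons !inE xA orbT.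
  have -> : (u == x) = false by apply: contraNF uA => /eqP ->.
  by move/(_ isT xt yt)/andP => [].
have uy : y \in t -> u != y by move/(subsetP tA) => yA; apply: contraNneq uA => ->.
move=> xA xt yt; rewrite prec_cons uy //= eq_sym.
by move: xA; rewrite inE in_set1; case: eqP => //= _ xA; apply: H.
Qed.

Lemma connected_ne e t : symmetric e -> (forall x y, x \in t -> y \in t -> x != y -> e x y) ->
  connected_on e t.
Proof.
move=> es H; apply/forall_inP => x xt; apply/forall_inP => y yt.
case: (eqVneq x y) => [-> //|xy]; apply: connect1.
by rewrite /= xt yt H.
Qed.

(** A set containing [u], other than the whole, follows the complete-graph walk while [u] is last,
    can only be lost as [u] moves forward, and is absent once [u] is first, as a vertex outside it
    would have to precede [u]. A set avoiding [u] is absent while its neighbour [u] is last, can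
    only be gained as [u] moves forward, and then follows the walk for [A]. *)
Lemma strip_cone e A u a b : symmetric e -> u \notin A -> a =i A ->
  {in A, forall x, e u x} ->
  strip (fun x y => x != y) A a b -> strip e A a b ->
  strip e (u |: A) (rcons b u) (u :: b).
Proof.
move=> e_sym uA aA eu [sK wK sKP] [sH wH sHP].
have wK' := walk_map (fun x y => @step_rcons _ u x y) (walk_rev wK).
have wB := bubble_walk u a.
have wH' := walk_map (fun x y => @step_cons _ u x y) wH.
(* Reversing the first walk gives the route [b], [a], [b], so that the result has again the shape
   needed for iterating and for closing up. *)
exists (map (rcons^~ u) (rev sK) ++ bubble u a ++ map (cons u) sH).
  exact: walk_cat wK' (walk_cat wB wH').
have KA w : w \in sK -> w =i A.
  by move=> /(walk_perm wK) /perm_mem H x; rewrite -H aA.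
move=> t t0 tA ct; case: (boolP (u \in t)) => ut.
  case: (eqVneq t (u |: A)) => [->|tnA].
    split; first by apply: conv_true => w _; apply: pres_top.
    by rewrite has_cat has_map has_rev; apply/orP; left; apply/hasP; exists a;
      rewrite ?(walk_first wK) //=; apply: pres_top.
  have E w : w \in sK -> pres e (u |: A) t (rcons w u) = pres (fun x y => x != y) A (t :\ u) w.
    by move=> wK0; apply: pres_rcons => //; apply: KA.
  have [c1 h1] : conv (pres (fun x y => x != y) A (t :\ u)) sK /\ has (pres (fun x y => x != y) A (t :\ u)) sK.
    (* For [t = [set u]] the strip of the complete graph says nothing, but [t] is present whenever
       [u] is last. *)
    case: (eqVneq (t :\ u) set0) => [->|tu0].
      have p0 w : pres (fun x y => x != y) A set0 w by apply/presP => x y _ _; rewrite inE.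
      split; first exact: conv_true.
      by apply/hasP; exists a; rewrite ?(walk_first wK).
    apply: sKP => //; last by apply: connected_ne => // x y; rewrite eq_sym.
    by rewrite subDset.
  split; last first.
    rewrite has_cat has_map has_rev; apply/orP; left.
    by case/hasP: h1 => w wK0 p; apply/hasP; exists w; rewrite //= E.
  rewrite catA; apply: conv_cat_none.
    apply: walk_conv_dec wK' wB _ (bubble_pres_dec _ _ _ ut).
    rewrite map_rev conv_rev /conv -map_comp.
    by rewrite (eq_in_map _ (pres (fun x y => x != y) A (t :\ u)) sK).1.
  rewrite has_map; apply/hasPn => w _ /=; apply/presP => H.
  have [x xA xt] : exists2 x, x \in A & x \notin t.
    apply/subsetPn; apply: contra tnA => At; rewrite eqEsubset tA.
    by rewrite subUset sub1set ut.
  have xn : nb e t x by apply/nbP; split=> //; exists u; rewrite // e_sym eu.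
  by have := H x u; rewrite inE xA orbT prec_cons eqxx => /(_ isT xn ut).
have tA' : t \subset A.
  apply/subsetP => y yt; have := subsetP tA y yt; rewrite !inE.
  by case: eqP => // yu; rewrite -yu yt in ut.
have [c1 h1] := sHP t t0 tA' ct.
have none : ~~ has (pres e (u |: A) t) (map (rcons^~ u) (rev sK)).
  rewrite has_map has_rev; apply/hasPn => w wK0; apply/negP => /presP H.
  case/set0Pn: t0 => y yt; have yA := subsetP tA' _ yt.
  have un : nb e t u by apply/nbP; split=> //; exists y => //; apply: eu.
  have := H u y (setU11 _ _) un yt; rewrite -cats1 /prec !index_cat !(KA w wK0).
  rewrite (negbTE uA) yA /= eqxx addn0 ltnNge; case/negP.
  by apply: ltnW; rewrite index_mem (KA w wK0).
split; last first.
  rewrite !has_cat; apply/orP; right; apply/orP; right; rewrite has_map.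
  by case/hasP: h1 => w wH0 p; apply/hasP; exists w; rewrite //= pres_cons.
apply: conv_none_cat none _; apply: walk_inc_conv wB wH' (bubble_pres_inc _ _ _ ut) _.
rewrite /conv -map_comp (eq_map (g := pres e A t)) //.
by move=> w /=; rewrite pres_cons.
Qed.

End Strips.

(** * Closing a strip into a cycle *)

Section Closure.
Variables (T : finType) (e : rel T).
Hypotheses (e_sym : symmetric e) (e_conn : connected_on e [set: T]).
Hypotheses (T_gt2 : 2 < #|T|).

(** The return walk rises at most once, and only if [p a] holds; then the run at the start of [s1]
    continues the run that ends [s2], and its own rise is not counted. *)
Lemma walk_crises p (s1 s2 : seq (seq T)) a b :
  walk s1 a b -> walk s2 b a -> conv p s1 -> inc p s2 \/ dec p s2 ->
  crises (map p (s1 ++ s2)) <= 1.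
Proof.
case=> s1' -> /andP [_ /eqP l1] [s2' -> /andP [_ /eqP l2]].
rewrite /conv /crises map_cat last_cat -[last _ (map p (b :: s2'))]/(last (p b) (map p s2')).
rewrite last_map l2 rises_cat.
rewrite -[last _ (map p (a :: s1'))]/(last (p a) (map p s1')) last_map l1.
move=> c1 m2; have {m2} : rises (p b) (map p (b :: s2')) <= p a.
  case: m2 => [i2|d2]; first by rewrite rises_inc ?implybb // l2; case: (p b).
  by rewrite rises_dec ?implybb.
by move: c1; rewrite /= andNb; case: (p a) => /=; lia.
Qed.

Lemma strip_facet_hamiltonian c l : uniq (c :: l) -> (forall x, x \in c :: l) ->
  strip e setT (rcons l c) (c :: l) -> exists C, facet_hamiltonian e C.
Proof.
move=> ul al [s ws sP].
have wB := walk_rev (bubble_walk c l); have wS := walk_cat ws wB.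
set S := s ++ _ in wS.
have pS w : w \in S -> uniq w /\ (forall x, x \in w).
  move/(walk_perm wS) => pw; split.
    by rewrite -(perm_uniq pw) rcons_uniq -cons_uniq.
  by move=> x; rewrite -(perm_mem pw) mem_rcons.
apply: (@facet_hamiltonian_once _ e e_sym e_conn T_gt2 (map (tubing_of e) S)); split.
- rewrite all_map; apply/allP => w /pS [_ aw]; exact: maximal_tubing_of.
- case: wS pS => S' -> /andP [pth lst] pS /=.
  (* The last word equals the first, so the closing edge is an equality. *)
  rewrite rcons_path last_map (eqP lst) /flip_or_eq eqxx andbT.
  elim: S' {lst} (rcons l c) pth pS => //= w' S' IH w /andP [st pth] pS.
  have [uw aw] := pS w (mem_head _ _).
  rewrite step_tubing //=; apply: IH => // v vS; apply: pS.
  by rewrite inE vS orbT.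
move=> t tt; have E w : (t \in tubing_of e w) = pres e setT t w by rewrite inE tt.
case/and3P: (tt) => t0 _ ct; have [c1 h1] := sP t t0 (subsetT _) ct.
rewrite -map_comp has_map /= (eq_map (g := pres e setT t)) //; split.
  rewrite has_cat; apply/orP; left; case/hasP: h1 => w ws0 pw.
  by apply/hasP; exists w => //=; rewrite E.
apply: walk_crises ws wB c1 _; rewrite inc_rev dec_rev.
case: (boolP (c \in t)) => ct'; first by left; apply: bubble_pres_dec.
by right; apply: bubble_pres_inc.
Qed.

End Closure.

(** * The graph families *)

Section CompleteSplit.
Variable T : finType.
Implicit Types (e : rel T) (u : T) (l K I : seq T).

Lemma set_cons u l : [set z in u :: l] = u |: [set z in l].
Proof. by apply/setP => z; rewrite !inE. Qed.

Lemma strip_edgeless e u l : {in u :: l &, forall x y, ~~ e x y} ->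
  strip e [set z in u :: l] (rcons l u) (u :: l).
Proof.
move=> H; exists (bubble u l); first exact: bubble_walk.
move=> t t0 tA _; have p w : pres e [set z in u :: l] t w.
  apply/presP => x y xA /nbP [_ [z zt exz]] _.
  have zA := subsetP tA z zt; rewrite !in_set in xA zA.
  by rewrite (negbTE (H x z xA zA)) in exz.
split; first exact: conv_true.
by apply/hasP; exists (u :: l) => //; apply: walk_last (bubble_walk u l).
Qed.

(** A cone over a complete graph is complete, so one and the same strip serves as both inputs of
    [strip_cone]. *)
Lemma strip_complete u l : uniq (u :: l) ->
  strip (fun x y => x != y) [set z in u :: l] (rcons l u) (u :: l).
Proof.
elim: l u => [|c l IH] u ul.
  by apply: strip_edgeless => x y; rewrite !inE => /eqP -> /eqP ->; rewrite eqxx.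
rewrite set_cons; have [uu uc] := andP ul; have Hs := IH c uc.
apply: (strip_cone _ _ _ _ Hs Hs); rewrite ?inE //.
- by move=> x y; rewrite eq_sym.
- by move=> x; rewrite inE mem_rcons.
- by move=> x; rewrite inE => xA; apply: contraNneq uu => ->.
Qed.

Lemma strip_complete_split e K I u l : symmetric e -> irreflexive e ->
  uniq (K ++ I) -> K ++ I = u :: l ->
  {in K & K ++ I, forall x y, x != y -> e x y} ->
  {in I &, forall x y, ~~ e x y} ->
  strip e [set z in u :: l] (rcons l u) (u :: l).
Proof.
move=> es ei + + + HI; elim: K u l => [|k K IH] u l /=.
  by move=> _ E _; rewrite E in HI; apply: strip_edgeless.
move=> uKI [<- E] HK; have [ku uKI'] := andP uKI.
case: l E => [|c l] E.
  (* A single remaining vertex has no strip below it to take the cone of; it is edgeless by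
     irreflexivity. *)
  by apply: strip_edgeless => x y; rewrite !inE => /eqP -> /eqP ->; rewrite ei.
rewrite set_cons; apply: (@strip_cone _ _ _ _ (rcons l c)).
- by [].
- by rewrite inE -E.
- by move=> x; rewrite inE mem_rcons.
- move=> x; rewrite inE -E => xA; apply: HK; rewrite ?inE ?eqxx ?xA ?orbT //.
  by apply: contraNneq ku => ->.
- by apply: strip_complete; rewrite -E.
apply: IH => // x y xK yA; apply: HK; rewrite inE ?xK ?yA orbT //.
Qed.

End CompleteSplit.

Lemma eq_in_inc (W : eqType) (p q : pred W) s :
  {in s, p =1 q} -> inc p s = inc q s.
Proof.
move=> H; apply: (@eq_in_pairwise _ (mem s)); last exact: allss.
by move=> x y xs ys /=; rewrite !H.
Qed.

(** * Insertion sort as a walk *)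

Section Sorting.
Variable T : eqType.
Implicit Types (w l : seq T).

(* An insertion sort from [rev l] to [l]; reading it backwards and mirrored
   gives another reduced path, from [l] to [rev l]. *)
Fixpoint sorting l :=
  if l is c :: l' then map (rcons^~ c) (sorting l') ++ bubble c l' else [:: [::]].

Definition unsorting l := map rev (rev (sorting (rev l))).

Lemma sorting_walk l : walk (sorting l) (rev l) l.
Proof.
elim: l => [|c l IH] /=; first exact: walk1.
rewrite rev_cons; apply: walk_cat (bubble_walk c l).
exact: walk_map (fun x y => @step_rcons _ c x y) IH.
Qed.

Lemma unsorting_walk l : walk (unsorting l) l (rev l).
Proof.
have := walk_map (@step_rev T) (walk_rev (sorting_walk (rev l))).
by rewrite !revK.
Qed.

Lemma sorting_mem l w x : w \in sorting l -> (x \in w) = (x \in l).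
Proof. by move/(walk_perm (sorting_walk l))/perm_mem => <-; rewrite mem_rev. Qed.

Lemma sorting_uniq l w : w \in sorting l -> uniq w = uniq l.
Proof. by move/(walk_perm (sorting_walk l))/perm_uniq => <-; rewrite rev_uniq. Qed.

(** Each pair starts inverted and is swapped only once: pairs within the tail during the recursive
    phase, pairs with the head during the final [bubble]. *)
Lemma sorting_inc l x y : uniq l -> y \in l -> prec x y l ->
  inc (prec x y) (sorting l).
Proof.
elim: l => //= c l IH /andP [cl ul]; rewrite inE prec_cons.
case: (eqVneq c y) => //= cy yl xy.
rewrite /inc pairwise_cat; apply/and3P; split; last 1 first.
- by apply: bubble_inc; rewrite eq_sym.
- apply/allrelP => w w' /mapP [v vs ->] w'b.
  case: (eqVneq c x) xy => [<-|cx] /= xy.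
    rewrite -cats1 /prec !index_cat (sorting_mem _ vs) (negbTE cl) (sorting_mem _ vs) yl.
    by rewrite ltnNge (leq_trans (index_size y v)) ?leq_addr.
  by rewrite (bubble_prec w'b) 1?eq_sym // xy implybT.
rewrite pairwise_map -[pairwise _ _]/(inc (fun w => prec x y (rcons w c)) _).
case: (eqVneq c x) xy => [<- _|cx /= xy].
  rewrite (@eq_in_inc _ _ pred0); first by rewrite /inc; elim: (sorting l) => //= ? s ->; rewrite all_predT.
  move=> v vs /=; rewrite -cats1 /prec !index_cat !(sorting_mem _ vs) (negbTE cl) yl.
  by apply/negbTE; rewrite -leqNgt (leq_trans (index_size y v)) ?leq_addr.
rewrite (@eq_in_inc _ _ (prec x y)); first exact: IH.
by move=> v vs; rewrite prec_rcons // (sorting_mem _ vs) // (prec_mem xy).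
Qed.

Lemma prec_neq x y w : prec x y w -> x != y.
Proof. by apply: contraTneq => ->; rewrite /prec ltnn. Qed.

Lemma inc_precC s x y : x != y -> {in s, forall w, x \in w} ->
  inc (prec x y) s = dec (prec y x) s.
Proof.
move=> xy sx; apply: (@eq_in_pairwise _ (mem s)); last exact: allss.
by move=> v v' vs vs' /=; rewrite !(prec_total xy) ?sx // implybNN.
Qed.

Lemma sorting_dec l x y : uniq l -> y \in l -> prec x y l ->
  dec (prec y x) (sorting l).
Proof.
move=> ul yl xy; rewrite -inc_precC ?sorting_inc ?(prec_neq xy) //.
by move=> w ws; rewrite (sorting_mem _ ws) (prec_mem xy).
Qed.

(** Letters are inserted from the right end of [l], so [y] and [z] are in their final order before
    [x] gets past [y]. *)
Lemma sorting_between l w x y z : uniq l -> w \in sorting l ->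
  prec x y l -> prec y z l -> z \in l -> prec x y w -> prec z y w -> False.
Proof.
elim: l w => //= c l IH w /andP [cl ul]; rewrite mem_cat inE !prec_cons.
case: (eqVneq c y) => //= cy ws xy; case: (eqVneq c z) => //= cz.
move=> yz zl.
have yl := prec_mem yz.
case/orP: ws => [/mapP [v vs ->]|wb].
  have zE : prec z y (rcons v c) = prec z y v.
    by apply: prec_rcons; rewrite (sorting_mem _ vs).
  case: (eqVneq c x) xy => [<- _ H _|cx /= xy].
    move: H; rewrite -cats1 /prec !index_cat !(sorting_mem _ vs) (negbTE cl) yl.
    by rewrite ltnNge (leq_trans (index_size y v)) ?leq_addr.
  rewrite zE prec_rcons ?(sorting_mem _ vs) ?(prec_mem xy) //.
  exact: IH vs xy yz zl.
move=> _; rewrite (bubble_prec wb) 1?eq_sym //.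
by rewrite prec_total ?yz // (prec_neq yz).
Qed.

Lemma bubble_mem c l1 l2 : l1 ++ c :: l2 \in bubble c (l1 ++ l2).
Proof.
elim: l1 => [|a l1 IH] /=; first exact: walk_last (bubble_walk c l2).
by rewrite mem_rcons inE map_f ?orbT.
Qed.

(** The word is taken while the letters of [l1] are still at the end and the first letter of [l2]
    has just passed [l3]. *)
Lemma sorting_prefix l1 l2 l3 : exists w1 w2,
  perm_eq w1 l2 /\ w1 ++ w2 \in sorting (l1 ++ l2 ++ l3).
Proof.
elim: l1 => [|c l1 [w1 [w2 [p1 ws]]]] /=; last first.
  exists w1, (rcons w2 c); split=> //.
  by rewrite -rcons_cat mem_cat (map_f (rcons^~ c) ws).
case: l2 => [|c l2].
  by exists [::], l3; split=> //; apply: walk_last (sorting_walk _).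
exists (rcons l2 c), l3; split; first by rewrite perm_rcons.
by rewrite /= mem_cat cat_rcons bubble_mem orbT.
Qed.

Lemma unsorting_dec l x y : uniq l -> y \in l -> prec x y l ->
  dec (prec x y) (unsorting l).
Proof.
move=> ul yl xy; have xl := prec_mem xy.
rewrite /unsorting map_rev dec_rev /inc pairwise_map.
rewrite -[pairwise _ _]/(inc (fun w => prec x y (rev w)) _).
rewrite (@eq_in_inc _ _ (prec y x)); last first.
  by move=> w ws; rewrite prec_rev ?(sorting_uniq ws) ?rev_uniq ?(sorting_mem _ ws) ?mem_rev.
by apply: sorting_inc; rewrite ?rev_uniq ?mem_rev // prec_rev.
Qed.

Lemma unsorting_mem l w x : w \in unsorting l -> (x \in w) = (x \in l).
Proof. by move/(walk_perm (unsorting_walk l))/perm_mem => <-. Qed.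

Lemma unsorting_inc l x y : uniq l -> y \in l -> prec x y l ->
  inc (prec y x) (unsorting l).
Proof.
move=> ul yl xy; rewrite inc_precC ?unsorting_dec // 1?eq_sym ?(prec_neq xy) //.
by move=> w ws; rewrite (unsorting_mem _ ws).
Qed.

Lemma unsorting_suffix l1 l2 l3 : exists w1 w2,
  perm_eq w2 l2 /\ w1 ++ w2 \in unsorting (l1 ++ l2 ++ l3).
Proof.
have [w1 [w2 [p ws]]] := sorting_prefix (rev l3) (rev l2) (rev l1).
exists (rev w2), (rev w1); split; first by rewrite perm_rev perm_sym -perm_rev perm_sym.
by rewrite /unsorting -rev_cat map_f // mem_rev !rev_cat -catA.
Qed.

End Sorting.

(** The increasing constraints together form an increasing condition, the others a decreasing one;
    [conv_inc_dec] intersects the two. *)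
Lemma conv_pres (T : finType) (e : rel T) (A t : {set T}) s :
  (forall x y, x \in A -> nb e t x -> y \in t ->
     inc (prec x y) s \/ dec (prec x y) s) -> conv (pres e A t) s.
Proof.
move=> H.
pose q (b : bool) w := [forall x in A, forall y in t,
  nb e t x && (inc (prec x y) s == b) ==> prec x y w].
have qP b w : reflect (forall x y, x \in A -> nb e t x -> y \in t ->
    inc (prec x y) s = b -> prec x y w) (q b w).
  apply: (iffP forall_inP) => Q x.
    move=> y xA xt yt ib; have /forall_inP /(_ y yt) /implyP := Q x xA; apply.
    by rewrite xt ib eqxx.
  by move=> xA; apply/forall_inP => y yt; apply/implyP => /andP [xt /eqP]; apply: Q.
rewrite (@eq_in_conv _ _ (predI (q true) (q false))); last first.
  move=> w _; apply/presP/andP => [P|[/qP P1 /qP P2] x y xA xt yt].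
    by split; apply/qP => x y xA xt yt _; apply: P.
  by case E: (inc (prec x y) s); [apply: P1 | apply: P2].
apply: conv_inc_dec.
  apply/(incP _ [::]) => i j ij js /qP p; apply/qP => x y xA xt yt I.
  by apply: (incP _ _ _ I i j) => //; apply: p.
rewrite -inc_rev; apply/(incP _ [::]) => i j ij js /qP p; apply/qP => x y xA xt yt I.
have D : inc (prec x y) (rev s) by rewrite inc_rev; case: (H x y xA xt yt) => //; rewrite I.
by apply: (incP _ _ _ D i j) => //; apply: p.
Qed.

Lemma first_change (P : pred nat) j : P 0 != P j ->
  exists2 k, k < j & P k = P 0 /\ P k.+1 = P j.
Proof.
elim: j => [|j IH]; first by rewrite eqxx.
case: (eqVneq (P 0) (P j)) => [E _|N H]; first by exists j.
have [k kj [k0 k1]] := IH N; exists k; first exact: leqW.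
by split=> //; rewrite k1; move: N H; case: (P 0); case: (P j); case: (P j.+1).
Qed.

(** * Strips along a Hamiltonian path *)

Section HamiltonPath.
Variables (T : finType) (e : rel T) (c : T) (r : seq T).
Hypotheses (e_sym : symmetric e) (l_uniq : uniq (c :: r)).
Local Notation l := (c :: r).
Local Notation A := [set z in c :: r].
Implicit Types (t : {set T}).
Hypothesis l_path : {in l &, forall x y, index y l = (index x l).+1 -> e x y}.

Lemma path_change t y : y \in l -> (c \in t) != (y \in t) ->
  exists x z, [/\ x \in l, z \in l, e x z, index z l = (index x l).+1 &
    [/\ index x l < index y l, (x \in t) = (c \in t) & (z \in t) = (y \in t)]].
Proof.
move=> yl; pose P i := nth c l i \in t.
have -> : (c \in t) = P 0 by [].
have -> : (y \in t) = P (index y l) by rewrite /P nth_index.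
case/first_change=> k ky [Pk Pk1].
have ys : index y l < size l by rewrite index_mem.
have k1s : k.+1 < size l by apply: leq_ltn_trans ky ys.
have ks : k < size l by apply: ltnW.
exists (nth c l k), (nth c l k.+1); rewrite !mem_nth // !index_uniq //.
by split=> //; apply: l_path; rewrite ?mem_nth // !index_uniq.
Qed.

Lemma prec_behead x y : x \in r -> y \in r -> prec x y r = prec x y l.
Proof.
move=> xr yr; case/andP: l_uniq => cr _; rewrite prec_cons.
have -> : c != y by apply: contraNneq cr => ->.
by have -> : (c == x) = false by apply: contraNF cr => /eqP ->.
Qed.

(** During the sort of [l] each pair changes once, so presence is convex there. In the second half
    [c] is always first, which excludes every [t] that contains [c], except [A]. The two interval
    hypotheses provide a word at which [t] is present. *)
Lemma strip_hamilton_path :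
  (forall t, t != set0 -> t \subset A -> connected_on e t -> c \notin t ->
     exists l1 l2 l3, r = l1 ++ l2 ++ l3 /\ t =i l2) ->
  (forall t, t != set0 -> t \subset A -> connected_on e t -> c \in t ->
     exists l1 l2 l3, r = l1 ++ l2 ++ l3 /\ A :\: t =i l2) ->
  strip e A (rcons (rev r) c) (c :: rev r).
Proof.
move=> Hout Hin.
have w1 := sorting_walk l; have w2 := walk_map (fun x y => @step_cons _ c x y) (unsorting_walk r).
rewrite rev_cons in w1; exists (sorting l ++ map (cons c) (unsorting r)).
  exact: walk_cat w1 w2.
have /andP [cr ur] : (c \notin r) && uniq r := l_uniq.
move=> t t0 tA ct; have tl x : x \in t -> x \in l by move/(subsetP tA); rewrite inE.
have c1 : conv (pres e A t) (sorting l).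
  apply: conv_pres => x y xA /nbP [xt _] yt; rewrite inE in xA; have yl := tl y yt.
  have xy : x != y by apply: contraNneq xt => ->.
  case P: (prec x y l); first by left; apply: sorting_inc.
  by right; apply: sorting_dec; rewrite // prec_total ?P // eq_sym.
case: (boolP (c \in t)) => cT.
  case: (eqVneq t A) => [->|tnA].
    split; first by apply: conv_true => w _; apply: pres_top.
    by rewrite has_cat; apply/orP; left; apply/hasP; exists l; [apply: walk_last w1 | apply: pres_top].
  split.
    apply: conv_cat_none c1 _; rewrite has_map; apply/hasPn => w _ /=; apply/presP => H.
    have [y yl yt] : exists2 y, y \in l & y \notin t.
      have /subsetPn [y] : ~~ (A \subset t) by apply: contra tnA => At; rewrite eqEsubset tA.
      by rewrite inE; exists y.
    have [|x [z [xl zl exz _ [_ xt zt]]]] := @path_change t y yl; first by rewrite cT (negbTE yt).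
    have zn : nb e t z.
      by apply/nbP; rewrite zt (negbTE yt); split=> //; exists x; rewrite ?xt // e_sym.
    by have := H z c; rewrite inE => /(_ zl zn cT); rewrite prec_cons eqxx.
  have [l1 [l2 [l3 [El E2]]]] := Hin t t0 tA ct cT.
  (* In this word the vertices of [A] outside [t] form a prefix. *)
  have [w [w' [pw ww]]] := sorting_prefix (c :: l1) l2 l3.
  rewrite cat_cons -El in ww.
  rewrite has_cat; apply/orP; left; apply/hasP; exists (w ++ w') => //.
  apply/presP => x y xA /nbP [xt _] yt; apply: prec_cat.
    by rewrite (perm_mem pw) -E2 inE xt.
  by rewrite (perm_mem pw) -E2 inE yt.
have tr : {subset t <= r}.
  by move=> x xt; move: (tl x xt); rewrite inE; case: eqP => // E; rewrite -E xt in cT.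
have AE : A = c |: [set z in r] by rewrite set_cons.
have tA' : t \subset [set z in r] by apply/subsetP => x /tr; rewrite inE.
have cA' : c \notin [set z in r] by rewrite inE.
split; last first.
  have [l1 [l2 [l3 [El E2]]]] := Hout t t0 tA ct cT.
  have [w [w' [pw ww]]] := unsorting_suffix l1 l2 l3; rewrite -El in ww.
  rewrite has_cat has_map; apply/orP; right; apply/hasP; exists (w ++ w') => //=.
  rewrite AE pres_cons //; apply/presP => x y xA /nbP [xt _] yt; rewrite inE in xA.
  have pu : perm_eq r (w ++ w') by apply: walk_perm (unsorting_walk r) ww.
  have yw' : y \in w' by rewrite (perm_mem pw) -E2.
  apply: prec_cat.
    move: xA; rewrite (perm_mem pu) mem_cat => /orP [//|].
    by rewrite (perm_mem pw) -E2 (negbTE xt).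
  move: ur; rewrite (perm_uniq pu) cat_uniq => /and3P [_ /hasPn H _].
  exact: (H y yw').
(* If [t] is present at [l], where the two halves meet, all its constraints agree with [l], and the
   second half can only break them. *)
case: (boolP [forall x in A, forall y in t, nb e t x ==> prec x y l]) => [/presP P|].
  apply: walk_conv_dec w1 w2 c1 _; apply: pres_dec => x y xA xt yt.
  have xy := P x y xA xt yt; rewrite inE in xA.
  rewrite /dec pairwise_map -[pairwise _ _]/(dec (fun w => prec x y (c :: w)) _).
  have cy : c != y by apply: contraNneq cT => ->.
  rewrite -inc_rev (@eq_in_inc _ _ (fun w => (c == x) || prec x y w)); last first.
    by move=> w _; rewrite prec_cons cy.
  case: (eqVneq c x) => [_|cx] /=.
    by rewrite /inc; elim: (rev _) => //= ? s ->; rewrite andbT; elim: s.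
  rewrite -[inc _ _]/(inc (prec x y) _) inc_rev; apply: unsorting_dec => //; first exact: tr.
  rewrite prec_behead //; last exact: tr.
  by move: xA; rewrite inE eq_sym (negbTE cx).
case/forall_inPn=> z zA /forall_inPn [y yt]; rewrite negb_imply => /andP [zt nzy].
rewrite inE in zA; have zy : z != y by case/nbP: zt => zt _; apply: contraNneq zt => ->.
have yz : prec y z l by rewrite prec_total.
(* The path from [c] enters [t] no later than at [y], through a neighbour [x] that precedes [y]. As
   the neighbour [z] follows [y] in [l], [sorting_between] forbids [t] throughout the first half. *)
have [|x [x' [xl x'l exx' ix [xy xT x'T]]]] := @path_change t y (tl y yt); first by rewrite yt (negbTE cT).
have xn : nb e t x.
  by apply/nbP; rewrite xT; split=> //; exists x'; rewrite // x'T.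
apply: conv_none_cat.
  apply/hasPn => w ws; apply/presP => P; apply: (sorting_between l_uniq ws xy yz zA).
    by apply: P => //; rewrite inE.
  by apply: P => //; rewrite inE.
rewrite /conv -map_comp (eq_map (g := pres e [set z in r] t)); last first.
  by move=> w /=; rewrite AE pres_cons.
apply: conv_pres => u v uA /nbP [uT _] vt; rewrite inE in uA.
have vr := tr v vt; have uv : u != v by apply: contraNneq uT => ->.
case P: (prec u v r); first by right; apply: unsorting_dec.
by left; apply: unsorting_inc; rewrite // prec_total ?P // eq_sym.
Qed.

Lemma convex_factor (X : pred T) s : uniq s ->
  (forall x y z, prec x y s -> prec y z s -> z \in s -> X x -> X z -> X y) ->
  exists l1 l2 l3, s = l1 ++ l2 ++ l3 /\ forall x, (x \in s) && X x = (x \in l2).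
Proof.
elim: s => [|a s IH] /=; first by exists [::], [::], [::].
case/andP=> as_ us H; have [|l1 [l2 [l3 [E E2]]]] := IH us.
  move=> x y z xy yz zs; apply: H; rewrite ?inE ?zs ?orbT // prec_cons.
    rewrite xy orbT andbT; apply: contraNneq as_ => ->; exact: prec_mem yz.
  rewrite yz orbT andbT; by apply: contraNneq as_ => ->.
case Xa: (X a); last first.
  exists (a :: l1), l2, l3; rewrite E; split=> // x; rewrite -E -E2 inE.
  by case: eqP => //= ->; rewrite Xa andbF.
case: l2 E E2 => [|b l2] E E2.
  exists [::], [:: a], s; split=> // x; rewrite !inE; have := E2 x; rewrite in_nil.
  by case: eqP => //= ->; rewrite Xa.
(* If [l1] has a head [d], it lies between [a] and the first letter [b] of [l2]; convexity puts [d]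
   into [l2] as well, against uniqueness. *)
case: l1 E => [|d l1] E.
  exists [::], (a :: b :: l2), l3; rewrite E; split=> // x; rewrite -E !inE.
  by move: (E2 x); rewrite inE; case: (eqVneq x a) => [->|_] //= _; rewrite Xa.
have bs : b \in s by rewrite E !mem_cat mem_head !orbT.
have ds : d \in s by rewrite E inE eqxx.
have Xb : X b by have := E2 b; rewrite inE eqxx => /andP [].
have ad : a != d by apply: contraNneq as_ => ->.
have ab : a != b by apply: contraNneq as_ => ->.
have db : d != b.
  by apply: contraTneq us => db; rewrite E db /= !mem_cat mem_head !orbT.
have Xd : X d.
  apply: (H a d b) => //; rewrite ?prec_cons ?eqxx ?ad ?ab //=; last by rewrite inE bs orbT.
  by rewrite (negbTE ad) /= E prec_cons eqxx db.
have := E2 d; rewrite ds Xd => /esym db2.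
move: us; rewrite E cat_cons cons_uniq => /andP [+ _].
by rewrite !mem_cat db2 !orbT.
Qed.

(** The last two cases join [c] to the last vertex, so paths and cycles are treated together. *)
Hypothesis l_edge : {in l &, forall x y, e x y ->
  [\/ index y l = (index x l).+1, index x l = (index y l).+1,
      x = c /\ index y l = size r | y = c /\ index x l = size r]}.

(** Without [c] the graph is a path, whose connected sets are intervals. If [t] contains [c] and
    misses [x] and [z], no edge within [t] leaves the positions strictly between them, so [t] has no
    vertex there. *)
Lemma strip_path_cycle : strip e A (rcons (rev r) c) (c :: rev r).
Proof.
have /andP [cr ur] : (c \notin r) && uniq r := l_uniq.
have inj x y : x \in l -> y \in l -> index x l = index y l -> x = y.
  by move=> xl yl E; rewrite -(nth_index c xl) E nth_index.
have rl x : x \in r -> x \in l by rewrite inE orbC => ->.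
have idx x : x \in r -> 0 < index x l.
  by move=> xr; rewrite /= ifN //; apply: contraNneq cr => ->.
have idx' x : x \in r -> index x l <= size r.
  by move=> xr; rewrite -ltnS -[(size r).+1]/(size l) index_mem rl.
apply: strip_hamilton_path => t t0 tA ct cT.
  have tr : {subset t <= r}.
    by move=> x /[dup] xt /(subsetP tA); rewrite !inE; case: eqP => // E; rewrite -E xt in cT.
  have [|l1 [l2 [l3 [E E2]]]] := @convex_factor (fun x => x \in t) r ur; last first.
    exists l1, l2, l3; split=> // x; rewrite -E2 /=.
    by case: (boolP (x \in t)) => [/tr ->|]; rewrite ?andbF.
  move=> x y z; move=> xy yz zr xt zt; apply/negPn/negP => yt.
  have [xr yr] := (prec_mem xy, prec_mem yz).
  rewrite prec_behead // in xy; rewrite prec_behead // in yz.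
  have [||a [b [at_ bt aX bX eab]]] := @connected_cut _ _ _ [set v | prec v y l] x z ct xt zt.
  - by rewrite inE.
  - by rewrite inE /prec -leqNgt; apply: ltnW.
  have [ar br] := (tr a at_, tr b bt).
  have nby : index b l != index y l.
    by apply/eqP => /(inj _ _ (rl _ br) (rl _ yr)) E; rewrite -E bt in yt.
  move: aX bX; rewrite !inE -leqNgt /prec => aX bX.
  have ac : a <> c by move=> E; rewrite -E ar in cr.
  have bc : b <> c by move=> E; rewrite -E br in cr.
  have := l_edge (rl _ ar) (rl _ br) eab.
  have yb : index y l < index b l by rewrite ltn_neqAle eq_sym nby.
  case=> [E|E|[]//|[]//]; first by move: yb; rewrite E ltnS leqNgt aX.
  by move: aX; rewrite E ltnNge ltnW // ltnW.
have [|l1 [l2 [l3 [E E2]]]] := @convex_factor (fun x => x \notin t) r ur; last first.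
  exists l1, l2, l3; split=> // x; rewrite -E2 /= in_setD !inE andbC.
  by case: eqP => [->|] //=; rewrite cT /= andbF.
move=> x y z; move=> xy yz zr xt zt; apply/negP => yt.
have [xr yr] := (prec_mem xy, prec_mem yz).
rewrite prec_behead // in xy; rewrite prec_behead // in yz.
have [||a [b [at_ bt aX bX eab]]] :=
    @connected_cut _ _ _ [set v | prec x v l && prec v z l] y c ct yt cT.
- by rewrite inE xy yz.
- by rewrite inE /prec /= eqxx.
have [al bl] : a \in l /\ b \in l.
  by split; [move: (subsetP tA _ at_) | move: (subsetP tA _ bt)]; rewrite inE.
have nbx : index b l != index x l.
  by apply/eqP => /(inj _ _ bl (rl _ xr)) E; rewrite -E bt in xt.
have nbz : index b l != index z l.
  by apply/eqP => /(inj _ _ bl (rl _ zr)) E; rewrite -E bt in zt.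
move: aX bX; rewrite !inE /prec => aX bX.
have ix := idx x xr; have iz := idx' z zr.
have c0 : index c l = 0 by rewrite /= eqxx.
have := l_edge al bl eab.
case/andP: aX => xa az; case=> [E|E|[ac _]|[_ E]].
- by rewrite E in bX nbz; rewrite ltnS (ltnW xa) ltn_neqAle nbz az in bX.
- by rewrite E in xa az; rewrite (ltnW az) ltn_neqAle eq_sym nbx -ltnS xa in bX.
- by rewrite ac c0 in xa.
- by rewrite E ltnNge iz in az.
Qed.

End HamiltonPath.

(** * Assembling the cases *)

Section Families.
Variables (T : finType) (e : rel T).
Hypothesis e_sym : symmetric e.
Implicit Types (A : {set T}) (c : T) (l : seq T).

Lemma strip_path_on A : is_path_on e A -> A != set0 -> exists c l,
  [/\ uniq (c :: l), A = [set z in c :: l] & strip e A (rcons l c) (c :: l)].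
Proof.
case=> -[|c r] [us sA es] /set0Pn [x xA]; first by rewrite -sA in xA.
have AE : A = [set z in c :: r] by apply/setP => z; rewrite inE sA.
exists c, (rev r); rewrite !cons_uniq mem_rev rev_uniq -cons_uniq; split=> //.
  by rewrite AE; apply/setP => z; rewrite !inE mem_rev.
rewrite AE; apply: strip_path_cycle => // y z; rewrite !sA => yA zA.
  by move=> yz; rewrite es // /path_edge yz eqxx.
by rewrite es // => /orP [/eqP|/eqP]; [constructor 1|constructor 2].
Qed.

Lemma next_index (s : seq T) c r x y : s = c :: r -> uniq s -> x \in s ->
  (next s x == y) = if index x s < size r then (index y s == (index x s).+1) && (y \in s)
                    else y == c.
Proof.
move=> sE us xs; rewrite next_nth xs {1}sE.
have xr : index x s <= size r by rewrite -ltnS -[(size r).+1]/(size (c :: r)) -sE index_mem.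
(* At the last position [nth] returns its default [c], which is the wrap-around of the cycle. *)
case: ltnP => xr'; last by rewrite nth_default // eq_sym.
have -> : nth c r (index x s) = nth c s (index x s).+1 by rewrite {2}sE.
have xs1 : (index x s).+1 < size s by rewrite [size s](congr1 size sE).
apply/eqP/andP => [<-|[/eqP <- ys]]; last by rewrite nth_index.
by rewrite index_uniq // eqxx mem_nth.
Qed.

Lemma strip_cycle_on A : is_cycle_on e A -> exists c l,
  [/\ uniq (c :: l), A = [set z in c :: l] & strip e A (rcons l c) (c :: l)].
Proof.
case=> -[|c r] [us //= _ sA es].
have AE : A = [set z in c :: r] by apply/setP => z; rewrite inE sA.
exists c, (rev r); rewrite mem_rev rev_uniq; split=> //.
  by rewrite AE; apply/setP => z; rewrite !inE mem_rev.
have rE x : x \in c :: r -> index x (c :: r) <= size r.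
  by move=> xs; rewrite -ltnS -[(size r).+1]/(size (c :: r)) index_mem.
rewrite AE; apply: strip_path_cycle => // y z ys zs; have [yA zA] := (ys, zs).
  move=> yz; rewrite !sA in yA zA; rewrite es // /cycle_edge.
  rewrite (next_index _ (erefl _) us ys) yz eqxx zs.
  by rewrite -yz rE.
rewrite !sA in yA zA; rewrite es // /cycle_edge => /orP [].
  rewrite (next_index _ (erefl _) us ys); case: ltnP => yr.
    by case/andP=> /eqP; constructor 1.
  move/eqP => zc; constructor 4; split=> //.
  by apply/eqP; rewrite eqn_leq yr rE.
rewrite (next_index _ (erefl _) us zs); case: ltnP => zr.
  by case/andP=> /eqP; constructor 2.
move/eqP => yc; constructor 3; split=> //.
by apply/eqP; rewrite eqn_leq zr rE.
Qed.

Hypotheses (e_irr : irreflexive e) (e_conn : connected_on e [set: T]).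
Hypothesis T_gt2 : 2 < #|T|.

Lemma facet_hamiltonian_strip A c l : uniq (c :: l) -> A = [set z in c :: l] ->
  A = setT -> strip e A (rcons l c) (c :: l) -> exists C, facet_hamiltonian e C.
Proof.
move=> ul AE AT; rewrite AT; apply: strip_facet_hamiltonian => // x.
by have := in_setT x; rewrite -AT AE inE.
Qed.

Lemma facet_hamiltonian_cone u c l : universal e u -> uniq (c :: l) ->
  [set~ u] = [set z in c :: l] -> strip e [set~ u] (rcons l c) (c :: l) ->
  exists C, facet_hamiltonian e C.
Proof.
move=> eu ul AE H; have mE x : (x \in c :: l) = (x != u).
  by have /setP /(_ x) := AE; rewrite in_setC1 inE.
apply: (@facet_hamiltonian_strip (u |: [set~ u]) u (c :: l)).
- by rewrite cons_uniq ul mE eqxx.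
- by rewrite set_cons AE.
- exact: setUCr.
apply: strip_cone H => //.
- by rewrite !inE eqxx.
- by move=> x; rewrite mem_rcons in_setC1 mE.
- by move=> x; rewrite in_setC1; apply: eu.
by rewrite AE; apply: strip_complete.
Qed.

Lemma facet_hamiltonian_split (K I : seq T) : uniq (K ++ I) ->
  (forall x, x \in K ++ I) -> {in K & K ++ I, forall x y, x != y -> e x y} ->
  {in I &, forall x y, ~~ e x y} -> exists C, facet_hamiltonian e C.
Proof.
case E: (K ++ I) => [|u l] uKI aKI HK HI.
  by case/card_gt0P: (ltnW (ltnW T_gt2)) => x; have := aKI x.
apply: (strip_facet_hamiltonian e_sym e_conn T_gt2 uKI aKI).
have -> : [set: T] = [set z in u :: l] by apply/setP => z; rewrite !in_set aKI.
by apply: (strip_complete_split e_sym e_irr _ E _ HI); rewrite E.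
Qed.

End Families.

Theorem theorem1p5 (T : finType) (e : rel T)
    (e_sym : symmetric e) (e_irr : irreflexive e)
    (e_conn : connected_on e [set: T]) (T_gt2 : 2 < #|T|)
    (e_family : is_complete e \/ is_path e \/ is_cycle e \/ is_star e \/
                is_wheel e \/ is_fan e \/ is_complete_split e) :
  exists C : seq {set {set T}}, facet_hamiltonian e C.
Proof.
case: e_family => [H|[H|[H|[[[_ ac] [c uc]]|[[c H uc]|[[c H uc]|[K [I [KI dKI HK HI HKI]]]]]]]]].
(* A complete graph is a complete split graph with empty independent set. *)
- apply: (@facet_hamiltonian_split _ _ _ _ _ _ (enum T) [::]); rewrite ?cats0 ?enum_uniq //.
    by move=> x; rewrite mem_enum.
  by move=> x y _ _; apply: H.
- have T0 : [set: T] != set0 by rewrite -card_gt0 cardsT ltnW // ltnW.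
  have [c [l [ul AE st]]] := strip_path_on e_sym H T0.
  exact: facet_hamiltonian_strip ul AE _ st.
- have [c [l [ul AE st]]] := strip_cycle_on e_sym H.
  exact: facet_hamiltonian_strip ul AE _ st.
(* A star is a complete split graph whose clique is its center. *)
- apply: (@facet_hamiltonian_split _ _ _ _ _ _ [:: c] (enum [set~ c])) => //=.
  + by rewrite mem_enum !inE eqxx enum_uniq.
  + by move=> x; rewrite inE mem_enum !inE orbN.
  + by move=> x y; rewrite inE => /eqP -> _ cy; apply: uc; rewrite eq_sym.
  move=> x y; rewrite !mem_enum !inE => xc yc; apply/negP => exy.
  (* Two adjacent leaves would form a triangle with the center. *)
  apply: (ac [:: c; x; y]) => //; rewrite /ucycle /= !inE !negb_or.
  rewrite (uc _ xc) exy (e_sym y c) (uc _ yc) !(eq_sym c) xc yc /= andbT.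
  by apply: contraTneq exy => ->; rewrite e_irr.
- have [d [l [ul AE st]]] := strip_cycle_on e_sym H.
  exact: facet_hamiltonian_cone uc ul AE st.
- have c0 : [set~ c] != set0.
    by rewrite -card_gt0 cardsC1; case: #|T| T_gt2 => [|[]].
  have [d [l [ul AE st]]] := strip_path_on e_sym H c0.
  exact: facet_hamiltonian_cone uc ul AE st.
apply: (@facet_hamiltonian_split _ _ _ _ _ _ (enum K) (enum I)) => //.
- rewrite cat_uniq !enum_uniq /= andbT; apply/hasPn => x; rewrite !mem_enum => xI.
  by apply: contraL xI => xK; rewrite (disjointFr dKI xK).
- by move=> x; rewrite mem_cat !mem_enum -in_setU KI.
- move=> x y; rewrite mem_cat !mem_enum => xK /orP [yK xy|yI _]; first exact: HK.
  exact: HKI.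
by move=> x y; rewrite !mem_enum; apply: HI.
Qed.
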